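(* Let $P$ be a probability transition kernel on the finite or countable alphabet $G$, and let $a_k$, $\beta_m=\prod_{k=0}^m a_k$, the i.i.d. uniform sequence $\underline U=(U_i)_{i\in\mathbb Z}$, the regeneration times $\tau[s,t]$, the numbers $\rho_m$ and the map $\Phi$ be defined from $P$ as in the context. If $$\sum_{m\ge 0}\beta_m=\infty ,$$ then: (i) For each finite interval $[s,t]\subset\mathbb Z$, $\mathbb P(\tau[s,t]>-\infty)=1$. (ii) There exists a measurable function $\Phi:[0,1[^{\mathbb Z}\to G^{\mathbb Z}$, namely the one described in the context, such that the law $\mu:=\mathbb P(\Phi(\underline U)\in\cdot\,)$ of $\Phi(\underline U)$ is compatible with $P$. Moreover $\mu$ is stationary. (iii) In addition, $\Phi$ has the property that for each finite interval $[s,t]\subset\mathbb Z$, the restriction $\{\Phi(\underline U)(i): i\in[s,t]\}$ depends only on the values of $U_i$ in the interval $[\tau[s,t],t]$. More precisely, writing $\tau=\tau[s,t]$ (which is almost surely finite by (i)), for $i\in[s,t]$, $$\Phi(\underline U)(i)=\Phi(\dots,v_{\tau-2},v_{\tau-1},U_\tau,\dots,U_t,v_{t+1},\dots)(i)$$ for any sequence $\underline v\in[0,1[^{\mathbb Z}$. (iv) For each finite interval $[s,t]\subset\mathbb Z$ and each $m\in\mathbb N$, $$\mathbb P(s-\tau[s,t]>m)\;\le\;\sum_{i=0}^{t-s}\rho_{m+i}.$$ In particular, if $1-a_k$ decreases exponentially fast with $k$, then so does $\rho_k$. If $1-a_k\sim k^{-\gamma}$ with $\gamma>1$, then $\rho_k$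 decreases with the same power, i.e. $\rho_k=O(k^{-\gamma})$. (v) If $\beta:=\lim_{m\to\infty}\beta_m>0$, then items (i), (iii) and (iv) above hold also for $t=\infty$ (that is, for $[s,\infty]$ with $s\in\mathbb Z$; in (iii) there are then no coordinates to the right of $t$ to be replaced, and in (iv) the sum runs over all $i\ge 0$).
   Context: Notation. $\mathbb N=\{0,1,2,\dots\}$, $\mathbb N^*=\mathbb N\setminus\{0\}$, $-\mathbb N^*=\{-i:i\in\mathbb N^*\}$. Intervals $[s,t]$ are intervals of integers; $[s,\infty]$ means all integers $\ge s$. $G$ is a finite or countable set (alphabet), enumerated as $g_1,g_2,\dots$. Elements of $G^{-\mathbb N^*}$ are histories $w_{-\infty}^{-1}=(w_{-1},w_{-2},\dots)$, and $w_{-k}^{-1}=(w_{-1},\dots,w_{-k})$. $P:G\times G^{-\mathbb N^*}\to[0,1]$ is a probability transition kernel: $P(g\mid w_{-\infty}^{-1})\ge 0$ and $\sum_{g\in G}P(g\mid w_{-\infty}^{-1})=1$ for every history (measurable in the history). Compatibility. With $\eta(i)$, $i\in\mathbb Z$, the coordinate maps on $G^{\mathbb Z}$, a probability measure $\nu$ on $G^{\mathbb Z}$ is compatible with $P$ if for all $i\in\mathbb Z$, $g\in G$, $\nu(\eta(i)=g\mid \eta(i+j)=w_j,\ j\in-\mathbb N^* )=P(g\mid w_{-\infty}^{-1})$ for $\nu$-almost every past $w_{-\infty}^{-1}$. The numbers $a_k$. $a_0(g)=\inf\{P(g\mid z_{-\infty}^{-1}): z_{-\infty}^{-1}\in G^{-\mathbb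 N^*}\}$; for $k\ge1$, $a_k(g\mid w_{-k}^{-1})=\inf\{P(g\mid w_{-1},\dots,w_{-k},z_{-1},z_{-2},\dots): z_{-\infty}^{-1}\in G^{-\mathbb N^*}\}$ (for $k=0$, $a_0(g\mid w_0^{-1})$ means $a_0(g)$); and $a_k=\inf_{w_{-k}^{-1}}\sum_{g\in G}a_k(g\mid w_{-k}^{-1})$, $k\in\mathbb N$. Set $\beta_m=\prod_{k=0}^m a_k$. Regeneration times. $\underline U=(U_i)_{i\in\mathbb Z}$ are i.i.d. uniform on $[0,1[$ under $\mathbb P$. For $-\infty<s<\infty$ and $s\le t\le\infty$, $\tau[s,t]=\max\{m\le s: U_k<a_{k-m}\text{ for all }k\in[m,t]\}$, with $\max\emptyset=-\infty$. Write $\tau[n]=\tau[n,n]$, and $\tau[n](\underline u)$ for the same quantity computed with a deterministic sequence $\underline u\in[0,1[^{\mathbb Z}$ in place of $\underline U$. The numbers $\rho_m$. $\rho_m$ is the probability that the Markov chain on $\mathbb N$ started at $0$ at time $0$, with transition probabilities $p(x,x+1)=a_x$, $p(x,0)=1-a_x$, and $p(x,y)=0$ otherwise, is at $0$ at time $m$ (so $\rho_0=1$). The map $\Phi$. Put $b_0(g)=a_0(g)$ and, for $k\ge1$, $b_k(g\mid w_{-k}^{-1})=a_k(g\mid w_{-k}^{-1})-a_{k-1}(g\mid w_{-k+1}^{-1})$. For each history, let $\mathbf B_k(g\mid w_{-k}^{-1})$, $k\in\mathbb N$, $g\in G$ (written $\mathbf B_0(g)$ for $k=0$), be the intervals, closed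 on the left and open on the right, of length $b_k(g\mid w_{-k}^{-1})$, placed consecutively starting at $0$ in the order $\mathbf B_0(g_1),\mathbf B_0(g_2),\dots,\mathbf B_1(g_1\mid w_{-1}^{-1}),\mathbf B_1(g_2\mid w_{-1}^{-1}),\dots,\mathbf B_2(g_1\mid w_{-2}^{-1}),\dots$. For $\ell\le k$ let $\mathbf B_{\ell,k}(g\mid w_{-1},\dots,w_{-k})=[0,a_k[\,\cap\,\mathbf B_\ell(g\mid w_{-\ell}^{-1})$. Fix an arbitrary $g_0\in G$. Then $\Phi(\underline u)=\underline x=(x_n)_{n\in\mathbb Z}$, also written $\Phi(\underline u)(n)=x_n$, where: if $\tau[n](\underline u)=-\infty$, $x_n=g_0$; if $\tau=\tau[n](\underline u)>-\infty$, then recursively for $j=\tau,\tau+1,\dots,n$, $x_j$ is the unique $g\in G$ such that $u_j\in\bigcup_{0\le \ell\le j-\tau}\mathbf B_{\ell,j-\tau}(g\mid x_{j-1},\dots,x_\tau)$. ''Decreases exponentially fast'' for a nonnegative sequence $c_k$ means $c_k\le C\lambda^k$ for some $C<\infty$, $\lambda<1$. *)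

(* Defs.v *)
From HB Require Import structures.
From mathcomp Require Import all_boot all_order all_algebra finmap.
From mathcomp Require Import all_classical all_reals all_analysis.

Set Implicit Arguments.
Unset Strict Implicit.
Unset Printing Implicit Defensive.

Import Order.TTheory GRing.Theory Num.Theory numFieldNormedType.Exports.

Local Open Scope classical_set_scope.
Local Open Scope ring_scope.

(* Sets of families [x : I -> T] that constrain a single coordinate [i \in D]
   to lie in an event of [M]; they generate the sigma-algebra of the
   coordinates in [D]. *)
Definition coord_sets (I T : Type) (M : set (set T)) (D : set I) :
    set (set (I -> T)) :=
  [set A | exists2 i, D i & exists2 B, M B & A = [set x | B (x i)]].

(* [I -> T] with the product sigma-algebra: discrete on the alphabet [G], Borel
   on [R]. *)
Notation seqG G := (g_sigma_algebraType (@coord_sets int G setT setT)).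
Notation histG G := (g_sigma_algebraType (@coord_sets nat G setT setT)).
Notation seqR R := (g_sigma_algebraType (@coord_sets int R measurable setT)).

(* A history is [w : nat -> G] with [w i] standing for $w_{-(i+1)}$. *)
Definition past (T : Type) (x : int -> T) (n : int) : nat -> T :=
  fun i => x (n - i.+1%:Z).

(* $(w_{-1},\dots,w_{-k},z_{-1},z_{-2},\dots)$ *)
Definition splice (T : Type) (k : nat) (w z : nat -> T) : nat -> T :=
  fun i => if (i < k)%N then w i else z (i - k)%N.

Section Kernel.
Context {R : realType} {G : pointedType}.
Variable P : G -> (nat -> G) -> R.

Definition transition_kernel : Prop :=
  [/\ forall g w, 0 <= P g w,
      forall w, (\esum_(g in [set: G]) (P g w)%:E = 1)%E
    & forall g, measurable_fun [set: histG G] (P g : histG G -> R)].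

(* [a_word k g w] is $a_k(g\mid w_{-k}^{-1})$: only the first [k] entries of [w]
   matter. *)
Definition a_word (k : nat) (g : G) (w : nat -> G) : R :=
  inf [set P g (splice k w z) | z in [set: nat -> G]].

Definition a_tot (k : nat) : R :=
  inf [set fine (\esum_(g in [set: G]) (a_word k g w)%:E)%E
      | w in [set: nat -> G]].

Definition beta (m : nat) : R := \prod_(k < m.+1) a_tot k.

Definition b_word (k : nat) (g : G) (w : nat -> G) : R :=
  if k is k'.+1 then a_word k g w - a_word k' g w else a_word 0 g w.

(* [rk] is the position of a letter in the enumeration of the alphabet; the
   left end of $\mathbf B_k(g\mid w_{-k}^{-1})$ is the total length of the
   intervals of all lower levels and of those of level [k] that come earlier
   in the enumeration. *)
Definition Bleft (rk : G -> nat) (k : nat) (g : G) (w : nat -> G) : R :=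
  \sum_(l < k) fine (\esum_(h in [set: G]) (b_word l h w)%:E)%E +
  fine (\esum_(h in [set h | (rk h < rk g)%N]) (b_word k h w)%:E)%E.

Definition Bint (rk : G -> nat) (k : nat) (g : G) (w : nat -> G) : set R :=
  [set x | Bleft rk k g w <= x < Bleft rk k g w + b_word k g w].

Definition Bcut (rk : G -> nat) (l k : nat) (g : G) (w : nat -> G) : set R :=
  [set x | 0 <= x < a_tot k] `&` Bint rk l g w.

(* $\{m\le s : u_k<a_{k-m}\text{ for all }k\in[m,t]\}$; the right end [t] may
   be [+oo]. *)
Definition regen (u : int -> R) (s : int) (t : \bar int) : set int :=
  [set m | m <= s /\
    forall k : int, m <= k -> (k%:E <= t)%E -> u k < a_tot `|k - m|%N].

(* $\tau[s,t](\underline u)$: [xget] returns [-oo] when there is no maximum. *)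
Definition tau (u : int -> R) (s : int) (t : \bar int) : \bar int :=
  xget -oo%E [set x | exists m : int,
    [/\ x = m%:E%E, regen u s t m & forall m', regen u s t m' -> m' <= m]].

(* Transition probabilities of the chain defining $\rho_m$. *)
Definition hoc (x y : nat) : R :=
  if y == x.+1 then a_tot x else if y == 0%N then 1 - a_tot x else 0.

End Kernel.

(* Probability that the chain with transition probabilities [p] started at
   [x] is at [y] at time [m]. *)
Fixpoint nstep (R : realType) (p : nat -> nat -> R) (m x y : nat) : \bar R :=
  if m is m'.+1 then
    (\sum_(0 <= z <oo) (p x z)%:E * nstep p m' z y)%E
  else (x == y)%:R%:E.

Definition rho (R : realType) (G : pointedType) (P : G -> (nat -> G) -> R)
  (m : nat) : R := fine (nstep (hoc P) m 0 0).

Definition unit_seq (R : realType) : set (seqR R) :=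
  [set u | forall i, 0 <= u i < 1].

(* [Phi] is the map described in the construction. In the second clause [y]
   holds the letters computed recursively from time $m=\tau[n](u)$; its values
   outside $[m,n]$ are irrelevant, since [Bcut P rk l k g w] depends on the
   first [l <= j - m] entries of [w] only. *)
Definition is_Phi (R : realType) (G : pointedType) (P : G -> (nat -> G) -> R)
    (rk : G -> nat) (g0 : G) (Phi : seqR R -> seqG G) : Prop :=
  forall u, unit_seq u -> forall n : int,
    (tau P u n n%:E = -oo%E -> Phi u n = g0) /\
    (forall m : int, tau P u n n%:E = m%:E%E ->
      exists y : int -> G, Phi u n = y n /\
        forall j : int, m <= j <= n ->
          unique (fun g => exists2 l : nat, (l <= `|j - m|)%N &
                     Bcut P rk l `|j - m|%N g (past y j) (u j)) (y j)).

Definition replace_outside (T : Type) (b t : \bar int) (u v : int -> T) :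
    int -> T :=
  fun k => if (b <= k%:E <= t)%E then u k else v k.

(* [f] is a version of the conditional probability of [A] given the
   sub-sigma-algebra [F]. *)
Definition is_cond_prob d (T : measurableType d) (R : realType)
    (nu : probability T R) (F : set (set T)) (A : set T) (f : T -> R) : Prop :=
  (forall B : set R, measurable B -> F (f @^-1` B)) /\
  (forall C, F C -> (\int[nu]_(x in C) (f x)%:E = nu (A `&` C))%E).

Definition past_sigma (G : pointedType) (i : int) : set (set (seqG G)) :=
  <<s @coord_sets int G setT [set j | j < i] >>.

Definition compatible (R : realType) (G : pointedType)
    (P : G -> (nat -> G) -> R) (nu : probability (seqG G) R) : Prop :=
  forall (i : int) (g : G),
    is_cond_prob nu (@past_sigma G i) [set eta | eta i = g]
      (fun eta => P g (past eta i)).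

Definition stationary (R : realType) (G : pointedType)
    (nu : probability (seqG G) R) : Prop :=
  forall (n : int) (A : set (seqG G)), measurable A ->
    nu [set eta | A (fun i => eta (i + n))] = nu A.

Definition independent_family d (Omega : measurableType d) (R : realType)
    (Prob : probability Omega R) (U : int -> {RV Prob >-> R}) : Prop :=
  forall (J : {fset int}) (B : int -> set R), (forall j, measurable (B j)) ->
    Prob (\bigcap_(j in [set` J]) (U j @^-1` B j)) =
    (\prod_(j <- J) Prob (U j @^-1` B j))%E.

Definition iid_uniform d (Omega : measurableType d) (R : realType)
    (Prob : probability Omega R) (U : int -> {RV Prob >-> R}) : Prop :=
  [/\ independent_family U,
      forall i B, measurable B ->
        distribution Prob (U i) B = uniform_prob (@ltr01 R) B
    & forall omega, unit_seq (fun i => U i omega)].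

Definition exp_decay (R : realType) (c : nat -> R) : Prop :=
  exists C lambda : R, [/\ 0 <= lambda, lambda < 1 &
    forall k, c k <= C * lambda ^+ k].

(* Main.v *)
Require Import Defs.
From HB Require Import structures.
From mathcomp Require Import all_boot all_order all_algebra finmap.
From mathcomp Require Import all_classical all_reals all_analysis.
From mathcomp Require Import measurable_realfun.
From mathcomp Require Import ring lra zify.

Set Implicit Arguments.
Unset Strict Implicit.
Unset Printing Implicit Defensive.

Import Order.TTheory GRing.Theory Num.Theory numFieldNormedType.Exports.

Local Open Scope classical_set_scope.
Local Open Scope ring_scope.

(* A house-of-cards chain driven by u climbs from x to x + 1 at time k if u_k < a_x and otherwise
   falls to 0. Started from 0 just before time k <= s, it must visit 0 at some time in [s, t] as
   soon as tau[s, t] < k: otherwise its last visit to 0 before s would be followed by a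
   regeneration time. This bounds the tails of tau[s, t] by sums of the rho_m. Decomposing the
   first n steps of the chain according to its last visit to 0 gives
   sum_{j <= n} (a_0 ... a_{j-1}) rho_{n-j} = 1; as rho is nonincreasing, this yields
   rho_n * sum_{j <= n} a_0 ... a_{j-1} <= 1, hence rho_n -> 0, and sum_n rho_n <= 1 / beta.
   The decay rates come from the decomposition according to the first return to 0, whose law
   is bounded by 1 - a_k and has total mass 1 - beta < 1.
   Let letter(x, w) be the letter g whose intervals B_l(g | w), l in N, contain x. It only
   depends on w_{-1}, ..., w_{-k} when x < a_k. Hence Phi(u)(n) = letter(u_n, past of Phi(u))
   as soon as tau[n] is finite. Since U_n is independent of the past of Phi(U), the conditional
   probability of g lies, for every k, within 1 - a_k of a_k(g | w_{-k}^{-1}), and so does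
   P(g | w); moreover a_k -> 1. *)

(** * Enumerated masses *)

Definition agree (T : Type) (k : nat) (w w' : nat -> T) : Prop :=
  forall i, (i < k)%N -> w i = w' i.

Lemma agree_le (T : Type) k l (w w' : nat -> T) :
  (l <= k)%N -> agree k w w' -> agree l w w'.
Proof. by move=> lk kww i il; apply: kww; exact: leq_trans il lk. Qed.

Lemma splice_agree (T : Type) k (w w' : nat -> T) :
  agree k w w' -> w' = splice k w (fun i => w' (i + k)%N).
Proof.
move=> ww; apply/funext => i; rewrite /splice; case: ltnP => [/ww //|ki].
by rewrite subnK.
Qed.

Lemma agree_splice (T : Type) k (w z : nat -> T) : agree k w (splice k w z).
Proof. by move=> i ik; rewrite /splice ik. Qed.

Section EnumeratedMass.
Variables (R : realType) (G : pointedType) (rk : G -> nat).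
Hypothesis rk_inj : injective rk.
Variable f : G -> R.
Hypothesis f_ge0 : forall g, 0 <= f g.
Hypothesis f_fin : (\esum_(g in [set: G]) (f g)%:E < +oo)%E.

Definition below (n : nat) : R :=
  fine (\esum_(h in [set h | (rk h < n)%N]) (f h)%:E)%E.

Definition mass : R := fine (\esum_(g in [set: G]) (f g)%:E)%E.

Lemma esum_fin_num (D : set G) : (\esum_(g in D) (f g)%:E \is a fin_num)%E.
Proof.
rewrite ge0_fin_numE; last by apply: esum_ge0 => x _; rewrite lee_fin.
apply: le_lt_trans f_fin; rewrite esum_mkcond; apply: le_esum => g _.
by case: ifP => // _; rewrite lee_fin.
Qed.

Lemma esum_sub (D D' : set G) : D `<=` D' ->
  (\esum_(g in D) (f g)%:E <= \esum_(g in D') (f g)%:E)%E.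
Proof.
move=> DD; rewrite esum_mkcond [leRHS]esum_mkcond; apply: le_esum => g _.
case: ifPn => gD; last by case: ifP => // _; rewrite lee_fin.
by rewrite (mem_set (DD _ (set_mem gD))).
Qed.

Lemma below_mono m n : (m <= n)%N -> below m <= below n.
Proof.
move=> mn; apply: fine_le; rewrite ?esum_fin_num//.
by apply: esum_sub => g /= gm; exact: leq_trans mn.
Qed.

Lemma below_mass n : below n <= mass.
Proof. by apply: fine_le; rewrite ?esum_fin_num//; exact: esum_sub. Qed.

Lemma below0 : below 0 = 0.
Proof.
rewrite /below (_ : [set h | _] = set0) ?esum_set0//.
by apply/seteqP; split.
Qed.

Lemma below_letter g : below (rk g).+1 = below (rk g) + f g.
Proof.
rewrite /below (@esumID _ _ [set h | (rk h < rk g)%N]); last first.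
  by move=> h _; rewrite lee_fin.
rewrite fineD ?esum_fin_num//; congr (fine _ + _).
  congr esum; apply/seteqP; split => h /=; first by case.
  by move=> hg; split => //; exact: leqW.
rewrite (_ : _ `&` _ = [set g]) ?esum_set1 ?lee_fin//.
apply/seteqP; split => h /=; last by move=> ->; rewrite ltnS leqnn ltnn; split.
case; rewrite ltnS => hg /negP; rewrite -leqNgt => gh.
by apply: rk_inj; apply/eqP; rewrite eqn_leq hg gh.
Qed.

Lemma below_gap n : (forall g, rk g <> n) -> below n.+1 = below n.
Proof.
move=> gap; congr (fine _); congr esum; apply/seteqP; split => g /=; last exact: leqW.
by rewrite ltnS leq_eqVlt => /orP[/eqP/gap|].
Qed.

Lemma lt_below x : x < mass -> exists n, x < below n.
Proof.
move=> xm; have : (x%:E < \esum_(g in [set: G]) (f g)%:E)%E.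
  by rewrite -(fineK (esum_fin_num setT)) lte_fin.
move=> /ereal_sup_gt[y /= [F [finF _] <-]] xF.
have [n Fn] : exists n, forall g, F g -> (rk g < n)%N.
  exists (\sum_(g <- fset_set F) (rk g).+1)%N => g Fg.
  by rewrite (big_fsetD1 g) ?in_fset_set ?inE//= leq_addr.
exists n; rewrite -lte_fin /below fineK ?esum_fin_num//.
apply: lt_le_trans xF _; apply: esum_ge; exists F => //; split=> //.
Qed.

Lemma below_cover x : 0 <= x < mass ->
  exists g, below (rk g) <= x < below (rk g) + f g.
Proof.
move=> /andP[x0 xm]; have [n xn] := lt_below xm.
have /ex_minnP[m xbm minm] : exists n, x < below n by exists n.
case: m => [|m] in xbm minm *; first by rewrite below0 ltNge x0 in xbm.
have bm : below m <= x.
  by rewrite leNgt; apply/negP => /minm; rewrite ltnn.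
have [[g gm]|gap] := pselect (exists g, rk g = m).
  by exists g; rewrite -below_letter gm bm.
move: xbm; rewrite below_gap ?ltNge ?bm// => g gm.
by apply: gap; exists g.
Qed.

Lemma below_disjoint g h x : below (rk g) <= x < below (rk g) + f g ->
  below (rk h) <= x < below (rk h) + f h -> g = h.
Proof.
wlog gh : g h / (rk g <= rk h)%N.
  move=> W H1 H2; case/orP: (leq_total (rk g) (rk h)) => [?|?]; first exact: W.
  by apply/esym/W.
move=> /andP[_ xg] /andP[hx _].
move: gh; rewrite leq_eqVlt => /orP[/eqP/rk_inj //|gh].
have := below_mono gh; rewrite below_letter => lgh.
by have := lt_le_trans xg (le_trans lgh hx); rewrite ltxx.
Qed.

End EnumeratedMass.

(** * The infima a_k and the letter intervals *)

Section KernelWords.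
Variables (R : realType) (G : pointedType) (P : G -> (nat -> G) -> R).
Hypothesis hP : transition_kernel P.

Lemma kernel_ge0 g w : 0 <= P g w.
Proof. by case: hP. Qed.

Lemma a_word_set_lb k g w : has_lbound [set P g (splice k w z) | z in [set: nat -> G]].
Proof. by exists 0 => _ [z _ <-]; exact: kernel_ge0. Qed.

Lemma a_word_set_neq0 k g w : [set P g (splice k w z) | z in [set: nat -> G]] !=set0.
Proof. by exists (P g (splice k w w)); exists w. Qed.

Lemma a_word_ge0 k g w : 0 <= a_word P k g w.
Proof.
by apply: lb_le_inf => [|_ [z _ <-]]; [exact: a_word_set_neq0|exact: kernel_ge0].
Qed.

Lemma a_word_le k g w w' : agree k w w' -> a_word P k g w <= P g w'.
Proof.
move=> /splice_agree ->; apply: ge_inf; first exact: a_word_set_lb.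
by exists (fun i => w' (i + k)%N).
Qed.

Lemma a_word_agree k g w w' : agree k w w' -> a_word P k g w = a_word P k g w'.
Proof.
move=> ww; congr inf; apply/seteqP; split => _ [z _ <-]; exists z => //; congr P;
  apply/funext => i; rewrite /splice; case: ltnP => // /ww //.
Qed.

Lemma a_word_mono k l g w : (k <= l)%N -> a_word P k g w <= a_word P l g w.
Proof.
move=> kl; apply: lb_le_inf => [|_ [z _ <-]]; first exact: a_word_set_neq0.
by apply: a_word_le; apply: agree_le kl _; exact: agree_splice.
Qed.

Lemma a_word_esum_le1 k w : (\esum_(g in [set: G]) (a_word P k g w)%:E <= 1)%E.
Proof.
case: hP => _ P1 _; rewrite -(P1 w); apply: le_esum => g _.
by rewrite lee_fin a_word_le.
Qed.

Lemma a_word_esum_fin k w : (\esum_(g in [set: G]) (a_word P k g w)%:E < +oo)%E.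
Proof. by apply: le_lt_trans (a_word_esum_le1 k w) _; rewrite ltry. Qed.

Definition a_mass k w := fine (\esum_(g in [set: G]) (a_word P k g w)%:E)%E.

Lemma a_mass_ge0 k w : 0 <= a_mass k w.
Proof. by apply/fine_ge0/esum_ge0 => g _; rewrite lee_fin a_word_ge0. Qed.

Lemma a_massE k w : (\esum_(g in [set: G]) (a_word P k g w)%:E)%E = (a_mass k w)%:E.
Proof.
rewrite /a_mass fineK//; apply: esum_fin_num; last exact: a_word_esum_fin.
by move=> g; exact: a_word_ge0.
Qed.

Lemma a_mass_le1 k w : a_mass k w <= 1.
Proof. by rewrite -lee_fin -a_massE a_word_esum_le1. Qed.

Lemma a_mass_mono k l w : (k <= l)%N -> a_mass k w <= a_mass l w.
Proof.
move=> kl; rewrite -lee_fin -!a_massE; apply: le_esum => g _.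
by rewrite lee_fin a_word_mono.
Qed.

Lemma a_tot_set_neq0 k : [set a_mass k w | w in [set: nat -> G]] !=set0.
Proof. by exists (a_mass k (fun=> point)); exists (fun=> point). Qed.

Lemma a_tot_le k w : a_tot P k <= a_mass k w.
Proof.
apply: ge_inf; last by exists w.
by exists 0 => _ [z _ <-]; exact: a_mass_ge0.
Qed.

Lemma a_tot_ge0 k : 0 <= a_tot P k.
Proof.
by apply: lb_le_inf => [|_ [z _ <-]]; [exact: a_tot_set_neq0|exact: a_mass_ge0].
Qed.

Lemma a_tot_le1 k : a_tot P k <= 1.
Proof. exact: le_trans (a_tot_le k (fun=> point)) (a_mass_le1 _ _). Qed.

Lemma a_tot_mono k l : (k <= l)%N -> a_tot P k <= a_tot P l.
Proof.
move=> kl; apply: lb_le_inf => [|_ [z _ <-]]; first exact: a_tot_set_neq0.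
exact: le_trans (a_tot_le k z) (a_mass_mono _ kl).
Qed.

Lemma kernel_sub_a_word g k w w' : agree k w w' ->
  P g w' - a_word P k g w <= 1 - a_tot P k.
Proof.
move=> ww'; rewrite (a_word_agree g ww').
suff : P g w' - a_word P k g w' <= 1 - a_mass k w'.
  by move/le_trans; apply; rewrite lerD2l lerN2 a_tot_le.
have d0 h : 0 <= P h w' - a_word P k h w' by rewrite subr_ge0 a_word_le.
have e1 : (\esum_(h in [set: G]) (P h w' - a_word P k h w')%:E +
    (a_mass k w')%:E = 1)%E.
  case: hP => _ P1 _; rewrite -(P1 w') -a_massE -esumD.
  - by apply: eq_esum => h _; rewrite -EFinD subrK.
  - by move=> h _; rewrite lee_fin.
  - by move=> h _; rewrite lee_fin a_word_ge0.
have fin : (\esum_(h in [set: G]) (P h w' - a_word P k h w')%:E < +oo)%E.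
  rewrite ltey; apply/eqP => oo; move: e1; rewrite oo addye// => //.
rewrite -(lerD2r (a_mass k w')) subrK -lee_fin -e1 EFinD leeD2r//.
rewrite -[leLHS](@esum_set1 R G g (fun h => (P h w' - a_word P k h w')%:E)) ?lee_fin//.
by apply: esum_sub.
Qed.

Lemma b_word_ge0 k g w : 0 <= b_word P k g w.
Proof. by case: k => [|k]; rewrite /= ?a_word_ge0// subr_ge0 a_word_mono. Qed.

Lemma b_word_le k g w : b_word P k g w <= a_word P k g w.
Proof. by case: k => [|k] //=; rewrite lerBlDr lerDl a_word_ge0. Qed.

Lemma b_word_agree k g w w' : agree k w w' -> b_word P k g w = b_word P k g w'.
Proof.
case: k => [|k] ww /=; first exact: a_word_agree.
by congr (_ - _); apply: a_word_agree => //; exact: agree_le ww.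
Qed.

Lemma b_word_sum k g w : \sum_(l < k.+1) b_word P l g w = a_word P k g w.
Proof.
elim: k => [|k IH]; first by rewrite big_ord1.
by rewrite big_ord_recr/= IH addrC subrK.
Qed.

Lemma b_word_esum_fin k w : (\esum_(g in [set: G]) (b_word P k g w)%:E < +oo)%E.
Proof.
apply: le_lt_trans (a_word_esum_fin k w); apply: le_esum => g _.
by rewrite lee_fin b_word_le.
Qed.

Definition level_start k w := if k is k'.+1 then a_mass k' w else 0.

Lemma b_mass k w : mass (fun g => b_word P k g w) = a_mass k w - level_start k w.
Proof.
case: k => [|k]; first by rewrite subr0.
rewrite -[LHS](addrK (a_mass k w)) ; congr (_ - _).
rewrite /a_mass /mass -fineD.
- congr fine; rewrite -esumD.
  + by apply: eq_esum => g _; rewrite -EFinD subrK.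
  + by move=> g _; rewrite lee_fin b_word_ge0.
  + by move=> g _; rewrite lee_fin a_word_ge0.
- apply: esum_fin_num; last exact: b_word_esum_fin.
  by move=> g; exact: b_word_ge0.
- by rewrite a_massE.
Qed.

Lemma level_startE k w :
  level_start k w = \sum_(l < k) mass (fun g => b_word P l g w).
Proof.
elim: k => [|k IH]; first by rewrite big_ord0.
by rewrite big_ord_recr/= -IH b_mass addrC subrK.
Qed.

Section Intervals.
Variable rk : G -> nat.
Hypothesis rk_inj : injective rk.

Lemma BleftE k g w :
  Bleft P rk k g w = level_start k w + below rk (fun h => b_word P k h w) (rk g).
Proof. by rewrite level_startE. Qed.

Lemma Bint_level k g w x : Bint P rk k g w x -> level_start k w <= x < a_mass k w.
Proof.
rewrite /Bint/= BleftE => /andP[lx xr].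
have b0 h := b_word_ge0 k h w; have bf := b_word_esum_fin k w.
apply/andP; split.
  by apply: le_trans lx; rewrite lerDl -(below0 rk (fun h => b_word P k h w)) below_mono.
apply: lt_le_trans xr _; rewrite -addrA -below_letter//.
by rewrite -lerBrDl -b_mass; exact: below_mass.
Qed.

Lemma Bint_inj k l g h w x : Bint P rk k g w x -> Bint P rk l h w x ->
  k = l /\ g = h.
Proof.
wlog kl : k l g h / (k <= l)%N.
  move=> W H1 H2; case/orP: (leq_total k l) => [kl|lk]; first exact: W kl _ _.
  by have [-> ->] := W _ _ _ _ lk H2 H1.
move=> B1 B2; have /andP[_ x1] := Bint_level B1; have /andP[x2 _] := Bint_level B2.
case: l => [|l] in kl x2 B2 *.
  move: kl; rewrite leqn0 => /eqP k0; rewrite k0 in B1 *; split=> //.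
  apply: (below_disjoint rk_inj (fun g => b_word_ge0 0 g w) (b_word_esum_fin 0 w)
      (x := x)); move: B1 B2; rewrite /Bint/= !BleftE !add0r//.
move: kl; rewrite leq_eqVlt => /orP[/eqP k0|kl]; last first.
  by have := lt_le_trans x1 (le_trans (@a_mass_mono k l w kl) x2); rewrite ltxx.
rewrite k0 in B1 *; split=> //.
apply: (below_disjoint rk_inj (fun g => b_word_ge0 l.+1 g w)
  (b_word_esum_fin l.+1 w) (x := x - level_start l.+1 w));
  move: B1 B2; rewrite /Bint/= !BleftE -!addrA !lerBrDl !ltrBlDl//.
Qed.

Lemma Bint_cover k w x : 0 <= x < a_mass k w ->
  exists l g, (l <= k)%N /\ Bint P rk l g w x.
Proof.
move=> /andP[x0 xk].
have /ex_minnP[l xl minl] : exists l, x < a_mass l w by exists k.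
have lx : level_start l w <= x.
  case: l => [//|l] in xl minl *.
  by rewrite leNgt; apply/negP => /minl; rewrite ltnn.
have [g xg] : exists g, below rk (fun h => b_word P l h w) (rk g) <= x - level_start l w
    < below rk (fun h => b_word P l h w) (rk g) + b_word P l g w.
  apply: (below_cover rk_inj (fun g => b_word_ge0 l g w) (b_word_esum_fin l w)).
  by rewrite b_mass subr_ge0 lx/= ltrD2r.
exists l, g; split; first exact: minl.
by rewrite /Bint/= BleftE -addrA -lerBrDl -ltrBlDl.
Qed.

Lemma Bint_agree k g w w' : agree k w w' -> Bint P rk k g w = Bint P rk k g w'.
Proof.
move=> ww; rewrite /Bint !BleftE (b_word_agree g ww).
have -> : level_start k w = level_start k w'.
  case: k => [//|k] in ww *; rewrite /= /a_mass; congr fine.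
  by apply: eq_esum => h _; rewrite (a_word_agree h (agree_le (leqnSn k) ww)).
suff -> : below rk (fun h => b_word P k h w) = below rk (fun h => b_word P k h w').
  by [].
apply/funext => n; congr fine; apply: eq_esum => h _.
by rewrite (b_word_agree h ww).
Qed.

Definition letter (g0 : G) (x : R) (w : nat -> G) : G :=
  xget g0 [set g | exists l, Bint P rk l g w x].

Lemma letterE g0 x w g l : Bint P rk l g w x -> letter g0 x w = g.
Proof.
move=> B; rewrite /letter; case: xgetP => [h _ [m Bh]|/(_ g)].
  by have [] := Bint_inj Bh B.
by case; exists l.
Qed.

Lemma letter_Bint g0 x w k : 0 <= x < a_tot P k ->
  exists2 l, (l <= k)%N & Bint P rk l (letter g0 x w) w x.
Proof.
move=> /andP[x0 xk]; have [|l [g [lk B]]] := @Bint_cover k w x.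
  by rewrite x0 (lt_le_trans xk)// a_tot_le.
by exists l => //; rewrite (letterE g0 B).
Qed.

Lemma letter_agree g0 x w w' k : 0 <= x < a_tot P k -> agree k w w' ->
  letter g0 x w = letter g0 x w'.
Proof.
move=> xk ww; have [l lk B] := letter_Bint g0 w xk.
by apply/esym/(@letterE _ _ _ _ l); rewrite -(Bint_agree _ (agree_le lk ww)).
Qed.

End Intervals.
End KernelWords.

(** * Regeneration times and the map Phi *)

Section Tau.
Variables (R : realType) (G : pointedType) (P : G -> (nat -> G) -> R).

Lemma tau_regenP (u : int -> R) (s : int) (t : \bar int) m0 : regen P u s t m0 ->
  exists m : int, [/\ tau P u s t = m%:E%E, regen P u s t m
    & forall m', regen P u s t m' -> m' <= m].
Proof.
move=> rm0; have [m0s _] := rm0.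
have /ex_minnP[n /asboolP rn minn] : exists n : nat, `[< regen P u s t (s - n%:Z) >].
  exists `|s - m0|%N; apply/asboolP.
  by rewrite (_ : s - _ = m0)//; lia.
have maxn m' : regen P u s t m' -> m' <= s - n%:Z.
  move=> rm'; have [m's _] := rm'.
  have := minn `|s - m'|%N; rewrite (_ : s - _ = m'); last lia.
  by move/asboolP: rm' => -> /(_ isT); lia.
exists (s - n%:Z); split=> //.
rewrite /tau; case: xgetP => [x _ [m [-> rm maxm]]|/(_ (s - n%:Z)%:E%E)].
  by congr EFin; apply/eqP; rewrite eq_le maxn// maxm.
by case; exists (s - n%:Z).
Qed.

Lemma tauP (u : int -> R) (s : int) (t : \bar int) m :
  tau P u s t = m%:E%E <->
  regen P u s t m /\ forall m', regen P u s t m' -> m' <= m.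
Proof.
split=> [tm|[rm maxm]].
  move: tm; rewrite /tau; case: xgetP => [y _ [m' [-> rm' maxm']] [<-]|//].
  by split.
have [m' [-> rm' maxm']] := tau_regenP rm.
by congr EFin; apply/eqP; rewrite eq_le maxm// maxm'.
Qed.

Lemma tau_NyP (u : int -> R) (s : int) (t : \bar int) :
  (-oo < tau P u s t)%E <-> exists m, regen P u s t m.
Proof.
split=> [|[m /tau_regenP[m' [->]]]]; last by rewrite ltNyr.
rewrite /tau; case: xgetP => [x _ [m [-> rm _]]|//].
by exists m.
Qed.

Lemma regen_restrict (u : int -> R) (s : int) (t : \bar int) m j :
  regen P u s t m -> m <= j -> (j%:E <= t)%E -> regen P u j j%:E%E m.
Proof.
move=> [ms rm] mj jt; split=> // k mk kj; apply: rm => //.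
exact: le_trans kj jt.
Qed.

Lemma regen_agree (u v : int -> R) (s : int) (t : \bar int) m :
  (forall k, m <= k -> (k%:E <= t)%E -> u k = v k) ->
  regen P u s t m -> regen P v s t m.
Proof. by move=> uv [ms rm]; split=> // k mk kt; rewrite -uv//; exact: rm. Qed.

End Tau.

Section PhiMap.
Variables (R : realType) (G : pointedType) (P : G -> (nat -> G) -> R).
Variables (rk : G -> nat) (g0 : G).

(* The letters recursively computed at times m, ..., m + n - 1, the latest one first; the
   histories consulted on the way are completed by the constant [g0]. *)
Fixpoint word (u : int -> R) (m : int) (n : nat) : seq G :=
  if n is n'.+1 then
    letter P rk g0 (u (m + n'%:Z)) (nth g0 (word u m n')) :: word u m n'
  else [::].

Definition run (u : int -> R) (m j : int) : G :=
  if m <= j then head g0 (word u m `|j - m|%N.+1) else g0.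

Definition Phi_map (u : int -> R) (n : int) : G :=
  if tau P u n n%:E is m%:E%E then run u m n else g0.

Lemma size_word u m n : size (word u m n) = n.
Proof. by elim: n => [//|n IH] /=; rewrite IH. Qed.

Lemma past_run u m n : past (run u m) (m + n%:Z) = nth g0 (word u m n).
Proof.
apply/funext => i; rewrite /past /run.
have [ni|ni] := leqP n i.
  by rewrite nth_default ?size_word// ifF//; apply/negP; lia.
rewrite ifT; last lia.
have -> : `|(m + n%:Z - i.+1%:Z)%R - m|%N.+1 = (n - i)%N by lia.
elim: n i ni => [//|n IH] [|i] ni; first by rewrite subn0.
by rewrite subSS IH.
Qed.

Lemma run_letter u m j : m <= j ->
  run u m j = letter P rk g0 (u j) (past (run u m) j).
Proof.
move=> mj; rewrite {1}/run mj /=.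
have {3 4}-> : j = m + `|j - m|%N%:Z by lia.
by rewrite past_run; congr letter; congr u; lia.
Qed.

Lemma run_agree u v m j : (forall k, m <= k <= j -> u k = v k) ->
  run u m j = run v m j.
Proof.
move=> uv; rewrite /run; case: ifPn => // mj; congr (head g0 _).
have : (`|j - m|.+1 <= `|j - m|.+1)%N by [].
elim: {1 3 4}(`|j - m|.+1)%N => [//|n IH] nj /=; rewrite IH; last exact: ltnW.
by congr (letter _ _ _ _ _ :: _); apply: uv; lia.
Qed.

Hypothesis hP : transition_kernel P.
Hypothesis rk_inj : injective rk.

Lemma run_Phi u j m : unit_seq u -> regen P u j j%:E%E m -> run u m j = Phi_map u j.
Proof.
move=> u1; have [k] := ubnP `|j - m|%N; elim: k j m => // k IH j m jmk rm.
have [m' [tm' rm' maxm']] := tau_regenP rm.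
have [mj _] := rm; have [m'j rm'u] := rm'; have mm' := maxm' _ rm.
rewrite /Phi_map tm' (run_letter _ mj) (run_letter _ m'j).
have xj : 0 <= u j < a_tot P `|j - m'|%N.
  by rewrite (rm'u j) ?lexx// andbT; case/andP: (u1 j).
apply: (letter_agree hP rk_inj g0 xj) => i ij; rewrite /past.
have ri m2 : m <= m2 -> m2 <= j - i.+1%:Z -> regen P u j j%:E%E m2 ->
    run u m2 (j - i.+1%:Z) = Phi_map u (j - i.+1%:Z).
  move=> mm2 m2i rm2; apply: IH; first by lia.
  by apply: (regen_restrict rm2) => //; rewrite lee_fin; lia.
by rewrite !ri//; lia.
Qed.

Lemma Phi_map_letter u n : unit_seq u -> (-oo < tau P u n n%:E)%E ->
  Phi_map u n = letter P rk g0 (u n) (past (Phi_map u) n).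
Proof.
move=> u1 /tau_NyP[m0 /tau_regenP[m [tm rm _]]].
have [mn rmu] := rm; rewrite {1}/Phi_map tm (run_letter _ mn).
have xn : 0 <= u n < a_tot P `|n - m|%N.
  by rewrite (rmu n) ?lexx// andbT; case/andP: (u1 n).
apply: (letter_agree hP rk_inj g0 xn) => i im; rewrite /past; apply: run_Phi => //.
by apply: (regen_restrict rm); rewrite ?lee_fin; lia.
Qed.

Lemma Phi_mapP : is_Phi P rk g0 Phi_map.
Proof.
move=> u u1 n; split=> [tn|m tm]; first by rewrite /Phi_map tn.
exists (run u m); split=> [|j /andP[mj jn]]; first by rewrite /Phi_map tm.
have [[_ rm] _] := (tauP _ _ _ _ _).1 tm.
have xj : 0 <= u j < a_tot P `|j - m|%N.
  by rewrite rm// ?lee_fin// andbT; case/andP: (u1 j).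
rewrite (run_letter _ mj); split.
  have [l ll B] := letter_Bint hP rk_inj g0 (past (run u m) j) xj.
  by exists l.
by move=> g [l _ [_ B]]; exact: (letterE hP rk_inj g0 B).
Qed.

Lemma Phi_map_local u v i m : regen P u i i%:E%E m ->
  (forall k, m <= k <= i -> u k = v k) -> Phi_map u i = Phi_map v i.
Proof.
move=> rm uv.
have [m1 [t1 r1 max1]] := tau_regenP rm; have mm1 := max1 _ rm.
have rv1 : regen P v i i%:E%E m1.
  by apply: regen_agree r1 => k mk; rewrite lee_fin => ki; apply: uv; lia.
have [m2 [t2 r2 max2]] := tau_regenP rv1; have m12 := max2 _ rv1.
have ru2 : regen P u i i%:E%E m2.
  by apply: regen_agree r2 => k mk; rewrite lee_fin => ki; apply/esym/uv; lia.
have e12 : m1 = m2 by apply/eqP; rewrite eq_le m12 max1.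
rewrite /Phi_map t1 t2 -e12; apply: run_agree => k /andP[mk ki].
by apply: uv; lia.
Qed.

Lemma Phi_map_replace_outside u v (s : int) (t : \bar int) (i : int) :
  (-oo < tau P u s t)%E -> s <= i -> (i%:E <= t)%E ->
  Phi_map u i = Phi_map (replace_outside (tau P u s t) t u v) i.
Proof.
move=> /tau_NyP[m0 /tau_regenP[m [tm rm _]]] si it.
have mi : m <= i by case: rm => ms _; exact: le_trans ms si.
apply: Phi_map_local (regen_restrict rm mi it) _ => k /andP[mk ki].
rewrite /replace_outside tm lee_fin mk ifT//=.
by apply: le_trans it; rewrite lee_fin.
Qed.

Lemma regen_shift u (s : int) t m (n : int) :
  regen P (fun i => u (i + n)) s t%:E%E m <-> regen P u (s + n) (t + n)%:E%E (m + n).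
Proof.
split=> -[ms rm]; split; try lia; move=> k mk.
- rewrite lee_fin => kt; have := rm (k - n).
  by rewrite lee_fin subrK (_ : k - n - m = k - (m + n)); [apply; lia|lia].
- rewrite lee_fin => kt; have := rm (k + n).
  by rewrite lee_fin (_ : k + n - (m + n) = k - m); [apply; lia|lia].
Qed.

Lemma word_shift u m n (p : int) :
  word (fun i => u (i + p)) m n = word u (m + p) n.
Proof.
elim: n => [//|n IH] /=; rewrite IH; congr (letter _ _ _ _ _ :: _).
by congr u; lia.
Qed.

Lemma Phi_map_shift u (p : int) n :
  Phi_map (fun i => u (i + p)) n = Phi_map u (n + p).
Proof.
have [[m0 r0]|nr] := pselect (exists m, regen P u (n + p) (n + p)%:E%E m).
  have [m [tm rm maxm]] := tau_regenP r0.
  rewrite {2}/Phi_map tm /Phi_map.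
  have -> : tau P (fun i => u (i + p)) n n%:E%E = (m - p)%:E%E.
    apply/tauP; split=> [|m' /regen_shift/maxm]; last lia.
    by apply/regen_shift; rewrite subrK.
  rewrite /run word_shift subrK (_ : n - (m - p) = n + p - m); last lia.
  by rewrite (_ : (m - p <= n) = (m <= n + p))//; apply/idP/idP; lia.
have tN v l : ~ (exists m, regen P v l l%:E%E m) -> Phi_map v l = g0.
  move=> nr'; rewrite /Phi_map; case tm: tau => [m| |]//.
  by case: nr'; exists m; case/tauP: tm.
by rewrite !tN// => -[m /regen_shift rm]; apply: nr; exists (m + p).
Qed.

End PhiMap.

(** * Measurability *)

Section MeasurablePredicates.
Context d (T : measurableType d).

Lemma measurable_prop (c : Prop) : measurable [set _ : T | c].
Proof.
have [hc|hc] := pselect c.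
  by rewrite (_ : [set _ | _] = setT)//; apply/seteqP; split.
by rewrite (_ : [set _ | _] = set0)//; apply/seteqP; split => // x /hc.
Qed.

Lemma measurable_imply (c : Prop) (A : set T) :
  (c -> measurable A) -> measurable [set x | c -> A x].
Proof.
have [hc mA|hc _] := pselect c.
  by rewrite (_ : [set x | _] = A); [exact: mA|apply/seteqP; split => x /=; [apply|move=> ? _]].
by rewrite (_ : [set _ | _] = setT)//; apply/seteqP; split => // x _ /hc.
Qed.

Lemma measurable_exists (I : Type) (A : I -> set T) : countable [set: I] ->
  (forall i, measurable (A i)) -> measurable [set x | exists i, A i x].
Proof.
move=> cI mA; rewrite (_ : [set x | _] = \bigcup_i A i).
  exact: countable_bigcupT_measurable.
by apply/seteqP; split => x /= [i]; exists i.
Qed.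

Lemma measurable_forall (I : Type) (A : I -> set T) : countable [set: I] ->
  (forall i, measurable (A i)) -> measurable [set x | forall i, A i x].
Proof.
move=> cI mA; rewrite (_ : [set x | _] = ~` [set x | exists i, (~` A i) x]).
  by apply/measurableC/measurable_exists => // i; exact: measurableC.
apply/seteqP; split => x /= H; first by case=> i; exact.
by move=> i; apply: contrapT => nAi; apply: H; exists i.
Qed.

End MeasurablePredicates.

Lemma countable_inj (T T' : Type) (f : T -> T') : injective f ->
  countable [set: T'] -> countable [set: T].
Proof.
move=> fi /countable_injP[h hi]; apply/countable_injP; exists (h \o f).
by move=> x y _ _ /hi /fi; apply; rewrite inE.
Qed.

Lemma countable_seq (T : Type) (rk : T -> nat) : injective rk ->
  countable [set: seq T].
Proof. by move=> ri; exact: countable_inj (inj_map ri) (countableP _). Qed.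

Notation realSeq R D := (g_sigma_algebraType (@coord_sets int R measurable D)).

Section CoordinateMeasurability.
Variables (R : realType) (G : pointedType) (P : G -> (nat -> G) -> R).
Variables (rk : G -> nat) (g0 : G).
Hypothesis hP : transition_kernel P.
Hypothesis rk_inj : injective rk.
Variable D : set int.

Lemma measurable_coord (j : int) (B : set R) : D j -> measurable B ->
  measurable [set u : realSeq R D | B (u j)].
Proof. by move=> Dj mB; apply: sub_sigma_algebra; exists j => //; exists B. Qed.

Lemma measurable_regen (s : int) (t : \bar int) (m : int) :
  (forall k, m <= k -> (k%:E <= t)%E -> D k) ->
  measurable [set u : realSeq R D | regen P u s t m].
Proof.
move=> mD; apply: measurableI; first exact: measurable_prop.
apply: measurable_forall => [|k]; first exact: countableP.
apply: measurable_imply => mk; apply: measurable_imply => kt.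
apply: (@measurable_coord k [set x | x < a_tot P `|k - m|%N]) (mD _ mk kt) _.
by rewrite -set_itvNyo; exact: measurable_itv.
Qed.

Lemma measurable_Bint k g w : measurable (Bint P rk k g w : set R).
Proof.
rewrite (_ : Bint P rk k g w =
  [set` `[Bleft P rk k g w, Bleft P rk k g w + b_word P k g w[])//.
Qed.

Lemma measurable_letter w g : measurable [set x : R | letter P rk g0 x w = g].
Proof.
rewrite (_ : [set x | _] = [set x : R | exists l, Bint P rk l g w x] `|`
   ([set _ | g = g0] `&` [set x | forall h : nat * nat, ~
      exists i, rk i = h.2 /\ Bint P rk h.1 i w x])).
  apply: measurableU.
    by apply: measurable_exists => // l; exact: measurable_Bint.
  apply: measurableI; first exact: measurable_prop.
  apply: measurable_forall => [|h]; first exact: countableP.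
  apply/measurableC.
  apply: measurable_exists => [|i]; first exact: countable_inj rk_inj (countableP _).
  by apply: measurableI; [exact: measurable_prop|exact: measurable_Bint].
apply/seteqP; split => x /=.
  rewrite /letter; case: xgetP => [h _ [l B] <-|nB <-]; first by left; exists l.
  by right; split => // -[l r] /= [i [_ B]]; apply: (nB i); exists l.
case=> [[l B]|[-> nB]]; first exact: (letterE hP rk_inj g0 B).
rewrite /letter; case: xgetP => [h _ [l B]|//].
by exfalso; apply: (nB (l, rk h)); exists h.
Qed.

Lemma measurable_word (m : int) n s : (forall k, m <= k < m + n%:Z -> D k) ->
  measurable [set u : realSeq R D | word P rk g0 u m n = s].
Proof.
elim: n s => [|n IH] s mD.
  exact: (@measurable_prop _ (realSeq R D) ([::] = s)).
case: s => [|g s].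
  by rewrite (_ : [set u | _] = set0)//; apply/seteqP; split.
rewrite (_ : [set u | _] = [set u : realSeq R D | word P rk g0 u m n = s] `&`
   [set u : realSeq R D | letter P rk g0 (u (m + n%:Z)) (nth g0 s) = g]).
  apply: measurableI; first by apply: IH => k mk; apply: mD; lia.
  apply: (@measurable_coord _ [set x | letter P rk g0 x (nth g0 s) = g]).
    by apply: mD; lia.
  exact: measurable_letter.
by apply/seteqP; split => u /=; [case=> <- ->|case=> -> <-].
Qed.

Lemma measurable_run (m j : int) g : (forall k, m <= k <= j -> D k) ->
  measurable [set u : realSeq R D | run P rk g0 u m j = g].
Proof.
move=> mD; rewrite /run; case mj: (m <= j) => /=; last first.
  exact: (@measurable_prop _ (realSeq R D) (g0 = g)).
rewrite (_ : [set u | _] = [set u : realSeq R D | exists s, head g0 s = g /\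
    word P rk g0 u m `|j - m|%N.+1 = s]).
  apply: measurable_exists => [|s]; first exact: countable_seq rk_inj.
  apply: measurableI; first exact: measurable_prop.
  by apply: measurable_word => k mk; apply: mD; lia.
apply/seteqP; split => u; first by eexists; split; last by [].
by move=> [s [<- <-]].
Qed.

Lemma measurable_tau (s : int) (t : \bar int) (m : int) :
  (forall k, (k%:E <= t)%E -> D k) ->
  measurable [set u : realSeq R D | tau P u s t = m%:E%E].
Proof.
move=> mD; rewrite (_ : [set u | _] = [set u : realSeq R D | regen P u s t m] `&`
    [set u : realSeq R D | forall m', ~ (m < m' /\ regen P u s t m')]).
  apply: measurableI; first by apply: measurable_regen => k _; exact: mD.
  apply: measurable_forall => [|m']; first exact: countableP.
  apply/measurableC/measurableI; first exact: measurable_prop.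
  by apply: measurable_regen => k _; exact: mD.
apply/seteqP; split => u /=.
  move=> /tauP[rm maxm]; split=> // m' [mm' /maxm]; lia.
move=> [rm maxm]; apply/tauP; split=> // m' rm'.
by rewrite leNgt; apply/negP => mm'; exact: (maxm m').
Qed.

Lemma measurable_Phi_map_letter n g : (forall k, k <= n -> D k) ->
  measurable [set u : realSeq R D | Phi_map P rk g0 u n = g].
Proof.
move=> nD.
have mtau m : measurable [set u : realSeq R D | tau P u n n%:E = m%:E%E].
  by apply: measurable_tau => k; rewrite lee_fin; exact: nD.
rewrite (_ : [set u | _] =
  [set u : realSeq R D | exists m : int, tau P u n n%:E = m%:E%E /\ run P rk g0 u m n = g] `|`
  ([set _ | g0 = g] `&` [set u | forall m : int, ~ (tau P u n n%:E = m%:E%E)])).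
  apply: measurableU.
    apply: measurable_exists => [|m]; first exact: countableP.
    apply: measurableI; first exact: mtau.
    by apply: measurable_run => k mk; apply: nD; lia.
  apply: measurableI; first exact: measurable_prop.
  by apply: measurable_forall => [|m]; [exact: countableP|apply: measurableC; exact: mtau].
apply/seteqP; split => u /=; rewrite /Phi_map.
  by case: tau => [m <-| <-| <-]; [left; exists m|right..].
by case: tau => [m [[m' [[<-] //]]|[_ /(_ m)]//]| |] [[m []//]|[]].
Qed.

Lemma measurable_Phi_map (D' : set int) : (forall i j, i <= j -> D' j -> D i) ->
  measurable_fun [set: realSeq R D]
    (Phi_map P rk g0 : _ -> g_sigma_algebraType (@coord_sets int G setT D')).
Proof.
move=> DD; apply: (@measurability _ _ (realSeq R D)
  (g_sigma_algebraType (@coord_sets int G setT D')) _ _ (@coord_sets int G setT D')) => //.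
move=> _ [_ [i D'i [B _ ->]] <-]; rewrite setTI.
rewrite (_ : _ @^-1` _ =
   [set u : realSeq R D | exists g, B g /\ Phi_map P rk g0 u i = g]).
  apply: measurable_exists => [|g]; first exact: countable_inj rk_inj (countableP _).
  apply: measurableI; first exact: measurable_prop.
  by apply: measurable_Phi_map_letter => k ki; exact: DD D'i.
by apply/seteqP; split => u /=; [exists (Phi_map P rk g0 u i)|move=> [g [? ->]]].
Qed.

End CoordinateMeasurability.

(** * Cylinders and uniform laws *)

Definition cyl (T : Type) (J : {fset int}) (B : int -> set T) : set (int -> T) :=
  [set u | forall j, j \in J -> B j (u j)].

Section CylinderUniqueness.
Context d (Omega : measurableType d) (R : realType) (Prob : probability Omega R).
Variables (D : set int) (A : set Omega).
Variables (u1 u2 : Omega -> realSeq R D).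
Hypothesis mA : measurable A.
Hypothesis mu1 : measurable_fun [set: Omega] u1.
Hypothesis mu2 : measurable_fun [set: Omega] u2.

Definition cylinders : set (set (int -> R)) :=
  [set E | exists (J : {fset int}) (B : int -> set R),
    [/\ forall j, measurable (B j), forall j, j \in J -> D j & E = cyl J B]].

Lemma cylinders_setI : setI_closed cylinders.
Proof.
move=> _ _ [J [B [mB JD ->]]] [J' [B' [mB' JD' ->]]].
exists (J `|` J')%fset, (fun j => (if j \in J then B j else setT) `&`
  (if j \in J' then B' j else setT)); split.
- by move=> j; apply: measurableI; case: ifP.
- by move=> j; rewrite inE => /orP[/JD|/JD'].
- apply/seteqP; split => u /=.
    by case=> uB uB' j _; split; case: ifP => //; [exact: uB|exact: uB'].
  move=> H; split => j jJ; have := H j; rewrite inE jJ ?orbT => /(_ isT)[] //.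
Qed.

Lemma cylinders_sigma : <<s cylinders >> = <<s @coord_sets int R measurable D >>.
Proof.
apply/seteqP; split.
  apply: smallest_sub; first exact: smallest_sigma_algebra.
  move=> _ [J [B [mB JD ->]]].
  rewrite (_ : cyl J B = [set u : realSeq R D | forall j, j \in J -> B j (u j)])//.
  apply: (@measurable_forall _ (realSeq R D)) => [|j]; first exact: countableP.
  apply: (@measurable_imply _ (realSeq R D)) => jJ.
  by apply: measurable_coord; [exact: JD|exact: mB].
apply: smallest_sub; first exact: smallest_sigma_algebra.
move=> _ [i Di [B mB ->]]; apply: sub_sigma_algebra.
exists [fset i]%fset, (fun=> B); split => //.
  by move=> j; rewrite inE => /eqP ->.
apply/seteqP; split => u /=; last by apply; rewrite inE.
by move=> uB j; rewrite inE => /eqP ->.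
Qed.

Lemma cylinder_law_unique :
  (forall J B, (forall j, j \in J -> D j) -> (forall j, measurable (B j)) ->
    (Prob (A `&` u1 @^-1` cyl J B) = Prob A * Prob (u2 @^-1` cyl J B))%E) ->
  forall E : set (realSeq R D), measurable E ->
    (Prob (A `&` u1 @^-1` E) = Prob A * Prob (u2 @^-1` E))%E.
Proof.
move=> cylE.
have pre1 E : measurable E -> measurable (u1 @^-1` E).
  by move=> mE; rewrite -[X in measurable X]setTI; exact: mu1.
have pre2 E : measurable E -> measurable (u2 @^-1` E).
  by move=> mE; rewrite -[X in measurable X]setTI; exact: mu2.
have mI E : measurable E -> measurable (A `&` u1 @^-1` E).
  by move=> mE; apply: measurableI => //; exact: pre1.
move=> E mE.
apply: (@dynkin_induction _ (realSeq R D) cylinders (fun E =>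
  Prob (A `&` u1 @^-1` E) = Prob A * Prob (u2 @^-1` E))%E).
- by rewrite cylinders_sigma.
- exact: cylinders_setI.
- by rewrite !preimage_setT setIT probability_setT mule1.
- by move=> _ [J [B [mB JD ->]]]; exact: cylE.
- move=> S mS IS.
  have e1 : (Prob (A `&` u1 @^-1` (~` S)) = Prob A - Prob (A `&` u1 @^-1` S))%E.
    rewrite preimage_setC -setDE measureD//; first exact: pre1.
    by apply: le_lt_trans (probability_le1 _ mA) _; rewrite ltry.
  have e2 : (Prob (u2 @^-1` (~` S)) = 1 - Prob (u2 @^-1` S))%E.
    by rewrite preimage_setC probability_setC//; exact: pre2.
  rewrite e1 e2 IS -(fineK (fin_num_measure Prob _ mA)).
  rewrite -(fineK (fin_num_measure Prob _ (pre2 S mS))) -EFinM -!EFinB -EFinM.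
  by rewrite mulrBr mulr1.
- move=> F mF tF IF; rewrite !preimage_bigcup setI_bigcupr.
  have mdis (u : Omega -> realSeq R D) : trivIset setT (fun n => u @^-1` F n).
    by move=> i j _ _ [x [Fi Fj]]; apply: (tF i j) => //; exists (u x).
  rewrite measure_bigcup//=; last 2 first.
  + by move=> i _; apply: mI; exact: mF.
  + by move=> i j _ _ [x [[_ Fi] [_ Fj]]]; apply: (tF i j) => //; exists (u1 x).
  rewrite measure_bigcup//=; last first.
    by move=> i _; apply: pre2; exact: mF.
  rewrite -(fineK (fin_num_measure Prob _ mA)) -nneseriesZl//.
  by apply: eq_eseriesr => i _; rewrite IF fineK// fin_num_measure.
- by rewrite -/measurable cylinders_sigma.
Qed.

End CylinderUniqueness.

Section Uniform.
Variable R : realType.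

Lemma uniform_prob_itv (x y : R) : 0 <= x -> x <= y -> y <= 1 ->
  uniform_prob (@ltr01 R) [set z | x <= z < y] = (y - x)%:E.
Proof.
move=> x0 xy y1; rewrite /uniform_prob integral_uniform_pdf setIidl; last first.
  by move=> z /= /andP[xz zy]; rewrite in_itv/= (le_trans x0 xz) (ltW (lt_le_trans zy y1)).
rewrite (_ : [set z | _] = [set` `[x, y[]); last first.
  by apply/seteqP; split => z; rewrite /= in_itv.
rewrite (eq_integral (fun=> 1%:E)); last first.
  move=> z; rewrite inE/= in_itv/= => /andP[xz zy].
  by rewrite /uniform_pdf (le_trans x0 xz) (ltW (lt_le_trans zy y1)) subr0 invr1.
rewrite integral_cst//= mul1e lebesgue_measure_itv/= lte_fin.
case: ltP => [_|yx]; first by rewrite -EFinD.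
by have -> : x = y; [apply/eqP; rewrite eq_le xy yx|rewrite subrr].
Qed.

Variables (G : pointedType) (P : G -> (nat -> G) -> R) (rk : G -> nat).
Hypothesis hP : transition_kernel P.
Hypothesis rk_inj : injective rk.

Lemma uniform_prob_Bint k g w :
  uniform_prob (@ltr01 R) (Bint P rk k g w) = (b_word P k g w)%:E.
Proof.
have b0 := b_word_ge0 hP k; have bf := b_word_esum_fin hP k w.
rewrite /Bint uniform_prob_itv ?lerDl ?b0//.
- by rewrite addrC addKr.
- rewrite BleftE// addr_ge0//; last first.
    by rewrite -(below0 rk (fun h => b_word P k h w)) below_mono.
  by case: k {b0 bf} => [//|k]; exact: a_mass_ge0.
- rewrite BleftE// -addrA -below_letter//.
  apply: le_trans (a_mass_le1 hP k w); rewrite -lerBrDl -b_mass//.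
  exact: below_mass.
Qed.

Lemma uniform_prob_Bint_upto k g w :
  uniform_prob (@ltr01 R) [set x | exists2 l, (l <= k)%N & Bint P rk l g w x] =
  (a_word P k g w)%:E.
Proof.
rewrite -b_word_sum; elim: k => [|k IH].
  rewrite big_ord1 -uniform_prob_Bint; congr uniform_prob.
  by apply/seteqP; split => x /=; [case=> l; rewrite leqn0 => /eqP ->|exists 0%N].
rewrite big_ord_recr EFinD -IH -[X in _ = (_ + X)%E]uniform_prob_Bint -measureU.
- congr uniform_prob; apply/seteqP; split => x /=.
    case=> l; rewrite leq_eqVlt => /orP[/eqP -> B|lk B]; first by right.
    by left; exists l.
  by case=> [[l lk B]|B]; [exists l => //; exact: leqW|exists k.+1].
- rewrite (_ : mkset _ = [set x | exists l, (l <= k)%N /\ Bint P rk l g w x]).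
    apply: measurable_exists => [|l]; first exact: countableP.
    by apply: measurableI; [exact: measurable_prop|exact: measurable_Bint].
  by apply/seteqP; split => x [l]; [exists l|case; exists l].
- exact: measurable_Bint.
- rewrite -subset0 => x [/= [l lk Bl] Bk].
  by have [lk1 _] := Bint_inj hP rk_inj Bl Bk; rewrite lk1 ltnn in lk.
Qed.

End Uniform.

Section IndependentUniforms.
Context d (Omega : measurableType d) (R : realType) (Prob : probability Omega R).
Variable U : int -> {RV Prob >-> R}.
Hypothesis U_iid : iid_uniform U.

Definition upath (omega : Omega) : int -> R := fun i => U i omega.

Lemma upath_unit omega : unit_seq (upath omega).
Proof. by case: U_iid => _ _; apply. Qed.

Lemma measurable_upath (D : set int) :
  measurable_fun [set: Omega] (upath : Omega -> realSeq R D).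
Proof.
apply: (@measurability _ _ _ (realSeq R D) _ _ (@coord_sets int R measurable D)) => //.
move=> _ [_ [i _ [B mB ->]] <-]; rewrite setTI.
rewrite (_ : _ @^-1` _ = U i @^-1` B)//.
by rewrite -[X in measurable X]setTI; exact: measurable_funP.
Qed.

Lemma measurable_upath_preimage (D : set int) (E : set (realSeq R D)) :
  measurable E -> measurable (upath @^-1` E).
Proof. by move=> mE; rewrite -[X in measurable X]setTI; exact: measurable_upath. Qed.

Lemma measurable_U_preimage i (B : set R) : measurable B -> measurable (U i @^-1` B).
Proof. by move=> mB; rewrite -[X in measurable X]setTI; exact: measurable_funP. Qed.

Lemma U_law i (B : set R) : measurable B ->
  Prob (U i @^-1` B) = uniform_prob (@ltr01 R) B.
Proof. by case: U_iid => _ /(_ i B) H _ /H. Qed.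

Lemma upath_cyl (J : {fset int}) (B : int -> set R) : (forall j, measurable (B j)) ->
  Prob (upath @^-1` cyl J B) = (\prod_(j <- J) uniform_prob (@ltr01 R) (B j))%E.
Proof.
move=> mB; case: U_iid => /(_ J B mB) ind _ _.
rewrite (_ : _ @^-1` _ = \bigcap_(j in [set` J]) (U j @^-1` B j)); last first.
  by apply/seteqP; split => omega /= H j; apply: H.
by rewrite ind; apply: eq_bigr => j _; rewrite U_law.
Qed.

Lemma U_indep (D : set int) i (B : set R) (E : set (realSeq R D)) : ~ D i ->
  measurable B -> measurable E ->
  (Prob (U i @^-1` B `&` upath @^-1` E) =
   uniform_prob (@ltr01 R) B * Prob (upath @^-1` E))%E.
Proof.
move=> nDi mB mE; rewrite -(U_law i)//.
apply: cylinder_law_unique mE => //.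
- exact: measurable_U_preimage.
- exact: measurable_upath.
- exact: measurable_upath.
move=> J C JD mC.
have niJ : i \notin J by apply/negP => /JD.
rewrite U_law// upath_cyl//.
rewrite (_ : _ `&` _ = upath @^-1` cyl (i |` J)%fset (fun j => if j == i then B else C j)).
  rewrite upath_cyl; last by move=> j; case: ifP.
  rewrite big_fsetU1//= eqxx; congr (_ * _)%E.
  apply: eq_fbigr => j jJ _; case: eqP => // ji.
  by rewrite ji (negPf niJ) in jJ.
apply/seteqP; split => omega /=.
  move=> [Bi Cu] j; rewrite !inE => /orP[/eqP ->|jJ]; first by rewrite eqxx.
  by case: eqP => [->//|_]; exact: Cu.
move=> H; split; first by have := H i; rewrite !inE eqxx; apply.
move=> j jJ; have := H j; rewrite !inE jJ orbT => /(_ isT).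
by case: eqP => // ji; rewrite ji (negPf niJ) in jJ.
Qed.

Lemma upath_shift (n : int) (E : set (seqR R)) : measurable E ->
  Prob [set omega | E (fun i => upath omega (i + n))] = Prob (upath @^-1` E).
Proof.
move=> mE; pose upath' omega : realSeq R setT := fun i => upath omega (i + n).
have mpath' : measurable_fun setT upath'.
  apply: (@measurability _ _ _ (realSeq R setT) _ _ (@coord_sets int R measurable setT)) => //.
  move=> _ [_ [i _ [B mB ->]] <-]; rewrite setTI.
  by rewrite (_ : _ @^-1` _ = U (i + n) @^-1` B)//; exact: measurable_U_preimage.
have := @cylinder_law_unique _ _ _ Prob setT setT upath' upath measurableT mpath'
  (@measurable_upath setT).
rewrite probability_setT => /(_ _ E mE); rewrite mul1e setTI; apply.
move=> J B _ mB; rewrite mul1e setTI upath_cyl//.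
rewrite (_ : _ @^-1` _ = upath @^-1` cyl [fset (j + n)%R | j in J]%fset (fun j => B (j - n))).
  rewrite upath_cyl//.
  rewrite big_imfset/=; last by move=> i j _ _ /addIr.
  by apply: eq_bigr => j _; rewrite addrK.
apply/seteqP; split => omega /= H j.
  by move=> /imfsetP[k /= kJ ->]; rewrite addrK; exact: H.
by move=> jJ; have := H (j + n); rewrite addrK; apply; apply/imfsetP; exists j.
Qed.

End IndependentUniforms.

(** * The house-of-cards chain *)

Section HouseOfCards.
Variables (R : realType) (a : nat -> R).
Hypothesis a_ge0 : forall k, 0 <= a k.
Hypothesis a_le1 : forall k, a k <= 1.
Hypothesis a_mono : forall k l, (k <= l)%N -> a k <= a l.

Fixpoint ret (n x : nat) : R :=
  if n is n'.+1 then a x * ret n' x.+1 + (1 - a x) * ret n' 0 else (x == 0)%:R.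

Definition surv (n : nat) : R := \prod_(k < n) a k.

Lemma ret_ge0 n x : 0 <= ret n x.
Proof.
elim: n x => [|n IH] x /=; first exact: ler0n.
by rewrite addr_ge0// mulr_ge0// ?IH// subr_ge0.
Qed.

Lemma ret_antitone n x y : (x <= y)%N -> ret n y <= ret n x.
Proof.
suff step m z : ret m z.+1 <= ret m z.
  elim: y => [|y IH]; first by rewrite leqn0 => /eqP ->.
  rewrite leq_eqVlt => /orP[/eqP -> //|xy].
  by apply: le_trans (step _ _) _; exact: IH.
have mono k i : (forall z, ret k z.+1 <= ret k z) -> ret k i <= ret k 0.
  by move=> H; elim: i => [//|i /(le_trans (H i))].
elim: m z => [|m IH] z /=; first by rewrite ler_nat; case: z.
have h1 := IH z.+1; have h2 := mono m z.+2 IH.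
have h3 := a_mono (leqnSn z); have h4 := a_ge0 z.
have h5 : 0 <= a z * (ret m z.+1 - ret m z.+2) by rewrite mulr_ge0// subr_ge0.
have h6 : 0 <= (a z.+1 - a z) * (ret m 0 - ret m z.+2) by rewrite mulr_ge0// subr_ge0.
lra.
Qed.

Lemma ret0_antitone n m : (n <= m)%N -> ret m 0 <= ret n 0.
Proof.
suff step k : ret k.+1 0 <= ret k 0.
  elim: m => [|m IH]; first by rewrite leqn0 => /eqP ->.
  rewrite leq_eqVlt => /orP[/eqP -> //|nm].
  by apply: le_trans (step _) _; exact: IH.
have : 0 <= a 0%N * (ret k 0 - ret k 1) by rewrite mulr_ge0// subr_ge0 ret_antitone.
rewrite /=; lra.
Qed.

Lemma surv0 : surv 0 = 1. Proof. by rewrite /surv big_ord0. Qed.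

Lemma survS n : surv n.+1 = surv n * a n.
Proof. by rewrite /surv big_ord_recr. Qed.

Lemma surv_ge0 n : 0 <= surv n.
Proof. by rewrite prodr_ge0. Qed.

Lemma surv_stepP n : surv n.+1 <= surv n.
Proof. by rewrite survS ler_piMr// surv_ge0. Qed.

Lemma surv_antitone m n : (m <= n)%N -> surv n <= surv m.
Proof.
elim: n => [|n IH]; first by rewrite leqn0 => /eqP ->.
rewrite leq_eqVlt => /orP[/eqP -> //|nm].
by apply: le_trans (surv_stepP _) _; exact: IH.
Qed.

Lemma surv_le1 n : surv n <= 1.
Proof. by rewrite -surv0 surv_antitone. Qed.

Lemma surv_ret n x : surv x * ret n x = surv (x + n) * ((x + n)%N == 0)%:R +
  \sum_(j < n) (surv (x + j) - surv (x + j).+1) * ret (n.-1 - j) 0.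
Proof.
elim: n x => [|n IH] x; first by rewrite big_ord0 addr0 addn0.
rewrite big_ord_recl/= addn0 subn0 addnS eqn0Ngt ltnS leq0n mulr0 add0r.
rewrite mulrDr !mulrA -survS IH eqn0Ngt addSn ltnS leq0n mulr0 add0r addrC.
congr (_ + _); first by rewrite survS mulrBr mulr1.
apply: eq_bigr => j _; rewrite /bump/= add1n addnS.
by case: n j {IH} => [[]//|n j]; rewrite subSS.
Qed.

(* Decomposition according to the time of the first return to 0. *)
Lemma first_return n :
  ret n.+1 0 = \sum_(j < n.+1) (surv j - surv j.+1) * ret (n - j) 0.
Proof. by have := surv_ret n.+1 0; rewrite surv0 mul1r /= mulr0 add0r. Qed.

(* Decomposition according to the time of the last visit to 0. *)
Lemma last_visit n : \sum_(j < n.+1) surv j * ret (n - j) 0 = 1.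
Proof.
elim: n => [|n IH]; first by rewrite big_ord1 surv0 mul1r.
rewrite big_ord_recl [X in X + _](_ : _ = ret n.+1 0); last by rewrite surv0 mul1r.
rewrite first_return -[RHS]IH -big_split/=.
by apply: eq_bigr => j _; rewrite /bump/= add1n subSS mulrBl subrK.
Qed.

Lemma ret_surv_sum n : ret n 0 * \sum_(j < n.+1) surv j <= 1.
Proof.
rewrite -[leRHS](last_visit n) mulr_sumr; apply: ler_sum => j _.
by rewrite mulrC ler_wpM2l ?surv_ge0// ret0_antitone// leq_subr.
Qed.

Lemma ret_sum_surv n : surv n * \sum_(j < n.+1) ret j 0 <= 1.
Proof.
rewrite -[leRHS](last_visit n) mulr_sumr (reindex_inj rev_ord_inj)/=.
apply: ler_sum => j _; rewrite subSS ler_wpM2r ?ret_ge0// surv_antitone//.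
by rewrite -ltnS.
Qed.

Lemma nstep_ret n x : nstep (fun x y =>
    if y == x.+1 then a x else if y == 0%N then 1 - a x else 0) n x 0 =
  (ret n x)%:E.
Proof.
elim: n x => [//|n IH] x.
set p := fun x y : nat => if y == x.+1 then a x else if y == 0%N then 1 - a x else 0 in IH *.
have -> : nstep p n.+1 x 0 = (\sum_(0 <= z <oo) (p x z)%:E * nstep p n z 0)%E by [].
under eq_eseriesr do rewrite IH -EFinM.
rewrite /p {p IH}.
rewrite (@nneseries_split _ _ _ x.+2) => [|k _]; last first.
  rewrite lee_fin mulr_ge0 ?ret_ge0//; case: ifP => // _; case: ifP => // _.
  by rewrite subr_ge0.
rewrite add0n [X in (_ + X)%E]eseries0 ?adde0; last first.
  move=> z xz _; rewrite ifF; last by apply/negP => /eqP zx; rewrite zx ltnn in xz.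
  by rewrite ifF ?mul0r//; apply/negP => /eqP z0; rewrite z0 in xz.
rewrite big_nat_recr//= big_ltn//= eqxx big_nat big1 ?adde0.
  by rewrite -EFinD addrC.
move=> z /andP[z0 zx]; rewrite ifF; last by apply/negP => /eqP zx'; rewrite zx' ltnn in zx.
by rewrite ifF ?mul0r//; apply/negP => /eqP z0'; rewrite z0' in z0.
Qed.

Lemma ret_cvg0 : (forall M, exists n, M <= \sum_(j < n) surv j) ->
  forall e, 0 < e -> exists n, forall m, (n <= m)%N -> ret m 0 <= e.
Proof.
move=> H e e0; have [n Hn] := H e^-1.
exists n => m nm; apply: le_trans (ret0_antitone nm) _.
have [S0|S0] := leP (\sum_(j < n.+1) surv j) 0.
  by have := surv_ge0 n; move: S0 Hn; rewrite big_ord_recr/=; have := e0; rewrite -invr_gt0; lra.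
have := ret_surv_sum n; have r0 := ret_ge0 n 0.
have h : e^-1 <= \sum_(j < n.+1) surv j.
  by rewrite big_ord_recr/=; have := surv_ge0 n; lra.
move=> h2; have : ret n 0 * e^-1 <= 1.
  by apply: le_trans h2; rewrite ler_wpM2l.
by rewrite ler_pdivrMr// mul1r.
Qed.

End HouseOfCards.

Section CardProcess.
Variables (R : realType) (a : nat -> R).

(* State, at time k + n - 1, of the house-of-cards chain driven by u, if its state at time
   k - 1 is x. *)
Fixpoint hoc_state (u : int -> R) (k : int) (x n : nat) : nat :=
  if n is n'.+1 then
    let y := hoc_state u k x n' in if u (k + n'%:Z) < a y then y.+1 else 0%N
  else x.

Lemma hoc_state_first u k x n :
  hoc_state u k x n.+1 = hoc_state u (k + 1) (if u k < a x then x.+1 else 0%N) n.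
Proof.
elim: n => [|n IH]; first by rewrite /= addr0.
have -> : hoc_state u k x n.+2 =
  if u (k + n.+1%:Z) < a (hoc_state u k x n.+1) then (hoc_state u k x n.+1).+1 else 0%N by [].
rewrite {}IH /= (_ : k + n.+1%:Z = k + 1 + n%:Z)//; lia.
Qed.

End CardProcess.

Section CardRegen.
Variables (R : realType) (G : pointedType) (P : G -> (nat -> G) -> R).

Lemma hoc_state_zero (u : int -> R) (s : int) (t : \bar int) (k : int) : k <= s ->
  ~ (exists2 m, k <= m & regen P u s t m) ->
  exists i : nat, ((s + i%:Z)%:E <= t)%E /\
    hoc_state (a_tot P) u k 0 (`|s - k|%N + i).+1 = 0%N.
Proof.
move=> ks nreg; apply: contrapT => ncard; apply: nreg.
pose Q j := hoc_state (a_tot P) u k 0 j == 0%N.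
have Qex : exists j, (j <= `|s - k|)%N && Q j by exists 0%N.
have Qub j : (j <= `|s - k|)%N && Q j -> (j <= `|s - k|)%N by case/andP.
have [j /andP[js /eqP j0] jmax] := ex_maxnP Qex Qub.
have pos i : (j < i)%N -> ((k + i%:Z - 1)%:E <= t)%E -> hoc_state (a_tot P) u k 0 i <> 0%N.
  move=> ji it i0; have [isk|ski] := leqP i `|s - k|.
    by have := jmax i; rewrite /Q i0 isk /= => /(_ isT); lia.
  apply: ncard; exists (i - `|s - k|.+1)%N.
  rewrite (_ : s + _ = k + i%:Z - 1); last lia.
  by rewrite (_ : (_ + _).+1 = i)//; lia.
have step i : ((k + (j + i)%N%:Z - 1)%:E <= t)%E \/ i = 0%N ->
    hoc_state (a_tot P) u k 0 (j + i) = i.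
  elim: i => [|i IH] [it|//]; rewrite ?addn0//.
  have it' : ((k + (j + i)%N%:Z - 1)%:E <= t)%E.
    by apply: le_trans it; rewrite lee_fin; lia.
  have := pos (j + i.+1)%N; rewrite addnS /= IH; last by left.
  rewrite -addnS; case: ifP => // _ /(_ _ it) H; exfalso; apply: H => //; lia.
exists (k + j%:Z); first lia.
split=> [|q mq qt]; first lia.
have qE : q = k + (j + `|q - (k + j%:Z)%R|)%N%:Z by lia.
have := step `|q - (k + j%:Z)%R|.+1; rewrite addnS.
rewrite (_ : k + _ - 1 = q); last lia.
move=> /(_ (or_introl qt)) /=.
rewrite step -?qE; first by case: ifP.
have [->|] := eqVneq `|q - (k + j%:Z)%R|%N 0%N; first by right.
by left; apply: le_trans qt; rewrite lee_fin; lia.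
Qed.

End CardRegen.

Section CardLaw.
Context d (Omega : measurableType d) (R : realType) (Prob : probability Omega R).
Variable U : int -> {RV Prob >-> R}.
Hypothesis U_iid : iid_uniform U.
Variable a : nat -> R.
Hypothesis a_ge0 : forall k, 0 <= a k.
Hypothesis a_le1 : forall k, a k <= 1.

Lemma measurable_hoc_state (D : set int) k x n y : (forall j, k <= j < k + n%:Z -> D j) ->
  measurable [set u : realSeq R D | hoc_state a u k x n = y].
Proof.
elim: n y => [|n IH] y kD; first exact: (@measurable_prop _ (realSeq R D) (x = y)).
have Dn : D (k + n%:Z) by apply: kD; lia.
rewrite (_ : [set u | _] = [set u : realSeq R D | exists z, hoc_state a u k x n = z /\
   [set v | (if v < a z then z.+1 else 0%N) = y] (u (k + n%:Z))]).
  apply: measurable_exists => // z; apply: measurableI.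
    by apply: IH => j jk; apply: kD; lia.
  apply: measurable_coord => //.
  rewrite (_ : [set v | _] = ([set v | v < a z] `&` [set _ | z.+1 = y]) `|`
     (~` [set v | v < a z] `&` [set _ | 0%N = y])).
    have m1 : measurable [set v | v < a z].
      by rewrite -set_itvNyo; exact: measurable_itv.
    apply: measurableU; apply: measurableI => //; try exact: measurable_prop.
    exact: measurableC.
  apply/seteqP; split => v /=; first by case: ifP => h <-; [left|right].
  by case=> -[]; [move=> ->|move=> /negP/negbTE ->].
apply/seteqP; split => u /=; last by case=> z [<-].
by move=> H; exists (hoc_state a u k x n).
Qed.

Lemma hoc_state_law n k x :
  Prob [set omega | hoc_state a (upath U omega) k x n = 0%N] = (ret a n x)%:E.
Proof.
elim: n k x => [|n IH] k x /=.
  case: x => [|x] /=.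
    by rewrite (_ : [set _ | _] = setT) ?probability_setT//; apply/seteqP; split.
  by rewrite (_ : [set _ | _] = set0) ?measure0//; apply/seteqP; split.
pose D := [set j : int | k < j].
pose E z := [set u : realSeq R D | hoc_state a u (k + 1) z n = 0%N].
have mE z : measurable (E z).
  by apply: measurable_hoc_state => j jk; rewrite /D/=; lia.
pose B1 := [set v : R | 0 <= v < a x]; pose B2 := [set v : R | a x <= v < 1].
have itvE (p q : R) : [set v : R | p <= v < q] = [set` `[p, q[].
  by apply/seteqP; split => v; rewrite /= in_itv.
have mB1 : measurable B1 by rewrite /B1 itvE; exact: measurable_itv.
have mB2 : measurable B2 by rewrite /B2 itvE; exact: measurable_itv.
rewrite (_ : [set _ | _] = (U k @^-1` B1 `&` upath U @^-1` E x.+1) `|`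
                          (U k @^-1` B2 `&` upath U @^-1` E 0%N)).
  have nDk : ~ D k by rewrite /D/=; lia.
  have mI B z : measurable B -> measurable (U k @^-1` B `&` upath U @^-1` E z).
    by move=> mB; apply: measurableI;
      [exact: measurable_U_preimage|exact: measurable_upath_preimage].
  transitivity (Prob (U k @^-1` B1 `&` upath U @^-1` E x.+1) +
                Prob (U k @^-1` B2 `&` upath U @^-1` E 0%N))%E.
    apply: measureU; [exact: mI|exact: mI|].
    rewrite -subset0 => omega [[/= /andP[_ h1] _] [/= /andP[h2 _] _]].
    by have := lt_le_trans h1 h2; rewrite ltxx.
  rewrite (U_indep U_iid nDk mB1 (mE _)) (U_indep U_iid nDk mB2 (mE _)).
  rewrite !uniform_prob_itv// !IH.
  by rewrite -!EFinM -EFinD subr0.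
apply/seteqP; split => omega.
  move=> H; have : hoc_state a (upath U omega) k x n.+1 = 0%N by [].
  rewrite hoc_state_first /B1 /B2 /E/= -/(upath U omega k).
  have /andP[u0 u1] := upath_unit U_iid omega k.
  rewrite u0 u1 andbT /=.
  by case: ltP => h c; [left|right].
rewrite -[[set _ | _] omega]/(hoc_state a (upath U omega) k x n.+1 = 0%N) hoc_state_first.
case=> -[/andP[h1 h2] h3]; rewrite -/(upath U omega k) in h1 h2.
  by rewrite h2.
by rewrite ltNge h1.
Qed.

End CardLaw.

(** * Tails of the regeneration times *)

Section RegenerationTail.
Context d (Omega : measurableType d) (R : realType) (Prob : probability Omega R).
Variable U : int -> {RV Prob >-> R}.
Hypothesis U_iid : iid_uniform U.
Variables (G : pointedType) (P : G -> (nat -> G) -> R).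
Hypothesis hP : transition_kernel P.

Let a_ge0 := a_tot_ge0 hP.
Let a_le1 := a_tot_le1 hP.
Let a_mono := a_tot_mono hP.

Lemma rhoE m : rho P m = ret (a_tot P) m 0.
Proof. by rewrite /rho (nstep_ret a_ge0 a_le1). Qed.

Lemma betaE m : beta P m = surv (a_tot P) m.+1.
Proof. by []. Qed.

Lemma tau_tailE u (s : int) (t : \bar int) (m : nat) :
  (m%:Z%:E < s%:E - tau P u s t)%E <->
  ~ exists2 k, s - m%:Z <= k & regen P u s t k.
Proof.
have [[k0 r0]|nr] := pselect (exists k, regen P u s t k); last first.
  split=> _; first by case=> k _ rk; apply: nr; exists k.
  suff -> : tau P u s t = -oo%E by rewrite ltry.
  apply/eqP; rewrite -leeNy_eq leNgt; apply/negP => /tau_NyP.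
  exact: nr.
have [k [-> rk maxk]] := tau_regenP r0.
rewrite -EFinB lte_fin; split=> [mk [k' sk' /maxk]|nk]; first lia.
have [//|sk] := ltP m%:Z (s - k).
by exfalso; apply: nk; exists k => //; lia.
Qed.

Lemma measurable_tail (s : int) (t : \bar int) (m : nat) :
  measurable [set omega | (m%:Z%:E < s%:E - tau P (upath U omega) s t)%E].
Proof.
rewrite (_ : [set _ | _] = upath U @^-1` (~` [set u : seqR R |
    exists k, s - m%:Z <= k /\ regen P u s t k])).
  apply: measurable_upath_preimage; apply: measurableC.
  apply: measurable_exists => [|k]; first exact: countableP.
  by apply: measurableI; [exact: measurable_prop|exact: measurable_regen].
apply/seteqP; split => omega /=.
  by move=> /tau_tailE nk [k [sk rk]]; apply: nk; exists k.
by move=> nk; apply/tau_tailE => -[k sk rk]; apply: nk; exists k.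
Qed.

Lemma tau_tail_le (s : int) (t : \bar int) (m : nat) : (s%:E <= t)%E ->
  (Prob [set omega | (m%:Z%:E < s%:E - tau P (upath U omega) s t)%E] <=
   \sum_(0 <= i <oo | ((s + i%:Z)%:E <= t)%E) (rho P (m + i))%:E)%E.
Proof.
move=> st; have r0 i : (0 <= (rho P i)%:E)%E by rewrite lee_fin rhoE ret_ge0.
case: m => [|m].
  apply: le_trans (probability_le1 _ (measurable_tail _ _ _)) _.
  rewrite nneseries_recl//; last by rewrite addr0.
  rewrite {1}rhoE/= leeDl//; apply: nneseries_ge0 => i _ _; exact: r0.
pose F i := [set omega | ((s + i%:Z)%:E <= t)%E /\
  hoc_state (a_tot P) (upath U omega) (s - m%:Z) 0 (m + i).+1 = 0%N].
have mC i : measurable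
    [set omega | hoc_state (a_tot P) (upath U omega) (s - m%:Z) 0 (m + i).+1 = 0%N].
  apply: (@measurable_upath_preimage _ _ _ _ U setT
    [set u | hoc_state (a_tot P) u (s - m%:Z) 0 (m + i).+1 = 0%N]).
  exact: measurable_hoc_state.
have mF i : measurable (F i).
  by apply: measurableI; [exact: measurable_prop|exact: mC].
have sub : [set omega | (m.+1%:Z%:E < s%:E - tau P (upath U omega) s t)%E] `<=`
    \bigcup_i F i.
  move=> omega /= /tau_tailE nk.
  have [||i [it ci]] := @hoc_state_zero _ _ P (upath U omega) s t (s - m%:Z); first lia.
    by case=> k sk rk; apply: nk; exists k => //; lia.
  exists i => //; split=> //; rewrite -[RHS]ci; congr hoc_state; lia.
apply: le_trans (measure_sigma_subadditive Prob mF (measurable_tail _ _ _) sub) _.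
rewrite [leRHS]eseries_mkcond; apply: lee_nneseries => [i _ _|i _]; first exact: measure_ge0.
case: ifP => it; last first.
  by rewrite /F (_ : [set _ | _] = set0) ?measure0//; apply/seteqP; split => // x [/=]; rewrite it.
rewrite addSn rhoE -(hoc_state_law U_iid a_ge0 a_le1 _ (s - m%:Z)).
by apply: (le_measure Prob (mem_set (mF i)) (mem_set (mC i))) => x [].
Qed.

Lemma tau_finite_of_tail (s : int) (t : \bar int) :
  (forall e : R, 0 < e -> exists m,
    (Prob [set omega | (m%:Z%:E < s%:E - tau P (upath U omega) s t)%E] <= e%:E)%E) ->
  Prob [set omega | (-oo < tau P (upath U omega) s t)%E] = 1%E.
Proof.
move=> H.
have mfin : measurable [set omega | (-oo < tau P (upath U omega) s t)%E].
  rewrite (_ : [set _ | _] = \bigcup_m ~` [set omega |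
      (m%:Z%:E < s%:E - tau P (upath U omega) s t)%E]).
    by apply: bigcupT_measurable => m; apply: measurableC; exact: measurable_tail.
  apply/seteqP; split => omega /=.
    move=> /tau_NyP[k rk]; exists `|s - k|%N => //= /tau_tailE; apply.
    by exists k => //; lia.
  move=> [m _ /= nt]; apply: contrapT => /tau_NyP nk; apply: nt.
  by apply/tau_tailE => -[k _ rk]; apply: nk; exists k.
suff : Prob (~` [set omega | (-oo < tau P (upath U omega) s t)%E]) = 0%E.
  rewrite probability_setC// -(fineK (fin_num_measure Prob _ mfin)) -EFinB.
  by move=> -[] /eqP; rewrite subr_eq0 => /eqP <-.
apply/eqP; rewrite eq_le measure_ge0 andbT; apply/lee_addgt0Pr => e e0.
have [m Hm] := H e e0; rewrite add0e; apply: le_trans Hm.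
apply: le_measure; rewrite ?inE; [exact: measurableC|exact: measurable_tail|].
move=> omega /= nk; apply/tau_tailE => -[k _ rk]; apply: nk; apply/tau_NyP.
by exists k.
Qed.

Lemma surv_unbounded : (\sum_(0 <= m <oo) (beta P m)%:E = +oo)%E ->
  forall M, exists n, M <= \sum_(j < n) surv (a_tot P) j.
Proof.
move=> boo M; apply: contrapT => nM.
have : (\sum_(0 <= m <oo) (beta P m)%:E <= M%:E)%E.
  apply: lime_le.
    by apply: is_cvg_nneseries => n _ _; rewrite lee_fin betaE surv_ge0.
  apply: nearW => n; rewrite sumEFin lee_fin leNgt; apply/negP => Mn.
  apply: nM; exists n.+1; apply: (le_trans (ltW Mn)).
  rewrite big_mkord big_ord_recl lerDr; exact: surv_ge0.
by rewrite boo leye_eq.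
Qed.

Lemma tau_tail_fin_le (s t : int) (m : nat) : s <= t ->
  (Prob [set omega | (m%:Z%:E < s%:E - tau P (upath U omega) s t%:E)%E] <=
   \sum_(i < `|t - s|%N.+1) (rho P (m + i))%:E)%E.
Proof.
move=> st; apply: le_trans (tau_tail_le _ _) _; rewrite ?lee_fin//.
rewrite eseries_mkcond (@nneseries_split _ _ _ `|t - s|%N.+1); last first.
  by move=> k _; case: ifP => // _; rewrite lee_fin rhoE ret_ge0.
rewrite add0n [X in (_ + X)%E]eseries0 ?adde0 => [|i ti _]; last first.
  by rewrite ifF//; apply/negbTE; rewrite lee_fin; lia.
rewrite big_mkord; apply: lee_sum => i _; case: ifP => // _.
by rewrite lee_fin rhoE ret_ge0.
Qed.

Lemma tau_finite (s t : int) : (\sum_(0 <= m <oo) (beta P m)%:E = +oo)%E -> s <= t ->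
  Prob [set omega | (-oo < tau P (upath U omega) s t%:E)%E] = 1%E.
Proof.
move=> boo st; apply: tau_finite_of_tail => e e0.
pose N := `|t - s|%N.+1.
have [|n Hn] := @ret_cvg0 R (a_tot P) a_ge0 a_le1 a_mono (surv_unbounded boo) (e / N%:R).
  by rewrite divr_gt0// ltr0n.
exists n; apply: le_trans (tau_tail_fin_le _ st) _.
rewrite sumEFin lee_fin.
apply: (@le_trans _ _ (\sum_(i < N) (e / N%:R))); last first.
  by rewrite sumr_const card_ord -[_ *+ N]mulr_natr divfK// pnatr_eq0.
by apply: ler_sum => i _; rewrite rhoE Hn// leq_addr.
Qed.

Lemma surv_ge_limn n : limn (beta P) <= surv (a_tot P) n.
Proof.
apply: le_trans (surv_stepP a_ge0 a_le1 n).
apply: (@nonincreasing_cvgn_ge _ (beta P)).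
  by move=> i j ij; rewrite !betaE surv_antitone.
apply: nonincreasing_is_cvgn; first by move=> i j ij; rewrite !betaE surv_antitone.
by exists 0 => _ [i _ <-]; rewrite betaE surv_ge0.
Qed.

Lemma tau_tail_inf_le (s : int) (m : nat) :
  (Prob [set omega | (m%:Z%:E < s%:E - tau P (upath U omega) s +oo)%E] <=
   \sum_(0 <= i <oo) (rho P (m + i))%:E)%E.
Proof.
apply: le_trans (tau_tail_le _ _) _; first by rewrite leey.
by under eq_eseriesl do rewrite leey.
Qed.

Lemma ret_tail_small : 0 < limn (beta P) -> forall e : R, 0 < e ->
  exists m, forall n, \sum_(i < n) ret (a_tot P) (m + i) 0 <= e.
Proof.
set b := limn _ => b0 e e0.
pose S n := \sum_(i < n) ret (a_tot P) i 0.
have Sub n : S n <= b^-1.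
  have : S n <= S n.+1 by rewrite /S big_ord_recr lerDl ret_ge0.
  move/le_trans; apply; rewrite -[b^-1]mul1r ler_pdivlMr//.
  apply: le_trans (ret_sum_surv a_ge0 a_le1 n); rewrite mulrC.
  by rewrite ler_wpM2r ?surv_ge_limn// sumr_ge0// => i _; exact: ret_ge0.
have hS : has_sup (range S).
  by split; [exists (S 0%N), 0%N|exists b^-1 => _ [n _ <-]].
have [_ [m _ <-] Hm] := sup_adherent e0 hS.
exists m => n; have := sup_upper_bound hS (ex_intro2 _ _ (m + n)%N I erefl).
rewrite {1}/S big_split_ord/= -/(S m); lra.
Qed.

Lemma tau_finite_inf (s : int) : 0 < limn (beta P) ->
  Prob [set omega | (-oo < tau P (upath U omega) s +oo)%E] = 1%E.
Proof.
move=> b0; apply: tau_finite_of_tail => e e0.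
have [m Hm] := ret_tail_small b0 e0.
exists m; apply: le_trans (tau_tail_inf_le _ _) _; apply: lime_le.
  by apply: is_cvg_nneseries => n _ _; rewrite lee_fin rhoE ret_ge0.
apply: nearW => n; rewrite sumEFin lee_fin big_mkord.
by apply: le_trans (Hm n); apply: ler_sum => i _; rewrite rhoE.
Qed.

End RegenerationTail.

(** * Compatibility and stationarity *)

Notation letterSeq G D := (g_sigma_algebraType (@coord_sets int G setT D)).

Lemma measurable_past (G : pointedType) (i : int) (D : set int) :
  (forall j, j < i -> D j) ->
  measurable_fun [set: letterSeq G D] (fun eta => past eta i : histG G).
Proof.
move=> iD; apply: (@measurability _ _ (letterSeq G D) (histG G) _ _
  (@coord_sets nat G setT setT)) => //.
move=> _ [_ [n _ [B _ ->]] <-]; rewrite setTI.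
apply: sub_sigma_algebra; exists (i - n.+1%:Z); first by apply: iD; lia.
by exists B.
Qed.

Lemma sub_coord_sigma (T : Type) (M : set (set T)) (D D' : set int) : D `<=` D' ->
  <<s coord_sets M D >> `<=` <<s coord_sets M D' >>.
Proof.
move=> DD; apply: smallest_sub; first exact: smallest_sigma_algebra.
move=> A [i Di [B MB ->]]; apply: sub_sigma_algebra.
by exists i; [exact: DD|exists B].
Qed.

Section Compatibility.
Context d (Omega : measurableType d) (R : realType) (Prob : probability Omega R).
Variable U : int -> {RV Prob >-> R}.
Hypothesis U_iid : iid_uniform U.
Variables (G : pointedType) (P : G -> (nat -> G) -> R) (rk : G -> nat) (g0 : G).
Hypothesis hP : transition_kernel P.
Hypothesis rk_inj : injective rk.

Definition chain (omega : Omega) : seqG G := Phi_map P rk g0 (upath U omega).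

Lemma measurable_chain (D : set int) :
  measurable_fun [set: Omega] (chain : Omega -> letterSeq G D).
Proof.
apply: (@measurableT_comp _ _ _ _ (realSeq R setT)); last exact: measurable_upath.
exact: measurable_Phi_map.
Qed.

Lemma chain_stationary (n : int) (A : set (seqG G)) : measurable A ->
  Prob (chain @^-1` [set eta | A (fun i => eta (i + n))]) = Prob (chain @^-1` A).
Proof.
move=> mA; pose E : set (seqR R) := [set u | A (Phi_map P rk g0 u)].
have mE : measurable E.
  rewrite -[X in measurable X]setTI.
  by apply: (measurable_Phi_map g0 hP rk_inj (D := setT) (D' := setT)).
rewrite -(upath_shift U_iid n mE); congr (Prob _).
apply/seteqP; split => omega; rewrite /E/= /chain;
  by rewrite (_ : (fun i => Phi_map P rk g0 (upath U omega) (i + n)) =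
     Phi_map P rk g0 (fun i => upath U omega (i + n)))//;
  apply/funext => j; rewrite Phi_map_shift.
Qed.

Hypothesis a_small : forall e : R, 0 < e -> exists k, 1 - a_tot P k <= e.
Hypothesis tau_fin : forall n : int,
  Prob [set omega | (-oo < tau P (upath U omega) n n%:E)%E] = 1%E.
Variables (i : int) (g : G) (C : set (seqG G)).
Hypothesis mC : past_sigma i C.

Let preC : set Omega := chain @^-1` C.

Let D0 : set int := [set j | j < i].

Let history k (x : int -> G) : seq G := mkseq (past x i) k.

Let nth_history k (x : int -> G) : agree k (nth g0 (history k x)) (past x i).
Proof. by move=> l lk; rewrite /history nth_mkseq. Qed.

Let measurable_preC0 : measurable [set u : realSeq R D0 | C (Phi_map P rk g0 u)].
Proof.
rewrite -[X in measurable X]setTI.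
apply: (measurable_Phi_map g0 hP rk_inj (D := D0) (D' := D0)) => //.
by move=> k j kj jD; exact: le_lt_trans kj jD.
Qed.

Let measurable_preC : measurable preC.
Proof. by rewrite -[X in measurable X]setTI; apply: (measurable_chain (D := D0)). Qed.

Let measurable_history k s :
  measurable [set u : realSeq R D0 | history k (Phi_map P rk g0 u) = s].
Proof.
rewrite (_ : [set u | _] = [set _ | size s = k] `&` [set u : realSeq R D0 |
    forall l, (l < k)%N -> Phi_map P rk g0 u (i - l.+1%:Z) = nth g0 s l]).
  apply: measurableI; first exact: measurable_prop.
  apply: measurable_forall => // l; apply: measurable_imply => _.
  by apply: measurable_Phi_map_letter => // j; rewrite /D0/=; lia.
apply/seteqP; split => u /=.
  by move=> <-; split=> [|l lk]; [exact: size_mkseq|rewrite nth_mkseq].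
move=> [sk H]; apply: (@eq_from_nth _ g0); rewrite size_mkseq// => l lk.
by rewrite nth_mkseq// -H.
Qed.

Let upto k s : set R := [set x | exists2 l, (l <= k)%N & Bint P rk l g (nth g0 s) x].

Let measurable_upto k s : measurable (upto k s).
Proof.
rewrite (_ : upto k s = [set x | exists l, (l <= k)%N /\ Bint P rk l g (nth g0 s) x]).
  apply: measurable_exists => // l.
  by apply: measurableI; [exact: measurable_prop|exact: measurable_Bint].
by apply/seteqP; split => x [l]; [exists l|case; exists l].
Qed.

Let event k s : set Omega :=
  [set omega | history k (chain omega) = s] `&` preC.

Let measurable_event k s : measurable (event k s).
Proof.
apply: (@measurable_upath_preimage _ _ _ _ U D0 ([set u | history k (Phi_map P rk g0 u) = s]
  `&` [set u | C (Phi_map P rk g0 u)])).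
exact: measurableI.
Qed.

Let hits k : set Omega :=
  [set omega | upto k (history k (chain omega)) (U i omega)] `&` preC.

Let hits_event k s : (Prob (hits k `&` event k s) =
  \int[Prob]_(omega in event k s) (a_word P k g (past (chain omega) i))%:E)%E.
Proof.
rewrite (eq_integral (cst (a_word P k g (nth g0 s))%:E)); last first.
  move=> omega; rewrite inE => -[/= hs _]; congr EFin.
  by apply/esym/a_word_agree; rewrite -hs; exact: nth_history.
rewrite integral_cst// -(uniform_prob_Bint_upto hP rk_inj).
rewrite (_ : hits k `&` event k s = U i @^-1` upto k s `&` upath U @^-1`
  ([set u : realSeq R D0 | history k (Phi_map P rk g0 u) = s] `&`
    [set u | C (Phi_map P rk g0 u)])).
  by rewrite (U_indep U_iid)//; [rewrite /D0/= ltxx|exact: measurableI].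
apply/seteqP; split => omega.
  by move=> [[/= h _] [/= hs c]]; rewrite hs in h.
by move=> [/= h [/= hs c]]; split; split => //=; rewrite /chain hs.
Qed.

Let measurable_a_word k :
  measurable_fun [set: Omega]
    (EFin \o (fun omega => a_word P k g (past (chain omega) i))).
Proof.
apply/measurable_EFinP => _ B mB; rewrite setTI.
rewrite (_ : _ @^-1` _ = [set omega | exists s, B (a_word P k g (nth g0 s)) /\
    history k (chain omega) = s]).
  apply: measurable_exists => [|s]; first exact: countable_seq rk_inj.
  apply: measurableI; first exact: measurable_prop.
  apply: (@measurable_upath_preimage _ _ _ _ U D0
    [set u | history k (Phi_map P rk g0 u) = s]).
  exact: measurable_history.
apply/seteqP; split => omega /=.
  move=> Ba; exists (history k (chain omega)); split=> //.
  by rewrite (a_word_agree P g (@nth_history k (chain omega))).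
by move=> [s [Bs hs]]; rewrite -(a_word_agree P g (@nth_history k (chain omega))) hs.
Qed.

(* Partition according to the (countably many) values of the last k letters, on each of
   which the infimum is constant and U_i is independent of the past. *)
Let hits_prob k : (Prob (hits k) =
  \int[Prob]_(omega in preC) (a_word P k g (past (chain omega) i))%:E)%E.
Proof.
have /countable_injP[e e_inj] := countable_seq rk_inj.
pose F n : set Omega := [set omega | e (history k (chain omega)) = n] `&` preC.
have FE n : (exists s, F n = event k s) \/ F n = set0.
  have [[s es]|ns] := pselect (exists s, e s = n); [left|right].
    exists s; apply/seteqP; split => omega [/= h c]; split => //=.
      by apply: e_inj; rewrite ?inE// es.
    by rewrite h.
  apply/seteqP; split => // omega [/= h _]; apply: ns.
  by exists (history k (chain omega)).
have mF n : measurable (F n) by have [[s ->]|->] := FE n.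
have tF : trivIset setT F by move=> m n _ _ [omega [[/= <- _] [/= <- _]]].
have FU : preC = \bigcup_n F n.
  apply/seteqP; split => [omega c|omega [n _ []]//].
  by exists (e (history k (chain omega))).
have hitsF n : (Prob (hits k `&` F n) =
    \int[Prob]_(omega in F n) (a_word P k g (past (chain omega) i))%:E)%E.
  have [[s ->]|->] := FE n; first exact: hits_event.
  by rewrite setI0 measure0 integral_set0.
have mhitsF n : measurable (hits k `&` F n).
  have [[s ->]|->] := FE n; last by rewrite setI0.
  rewrite (_ : _ `&` _ = U i @^-1` upto k s `&` event k s).
    by apply: measurableI => //; exact: measurable_U_preimage.
  apply/seteqP; split => omega; last by move=> [h [hs c]]; split; split => //=; rewrite hs.
  by move=> [[/= h _] [/= hs c]]; rewrite hs in h.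
rewrite [in RHS]FU ge0_integral_bigcup//; last 2 first.
- exact: measurable_funTS (measurable_a_word k).
- by move=> omega _; rewrite lee_fin a_word_ge0.
rewrite (_ : hits k = \bigcup_n (hits k `&` F n)).
  rewrite measure_bigcup//=.
    by rewrite eseries_mkcond; apply: eq_eseriesr => n _; rewrite in_setT; exact: hitsF.
  by move=> m n _ _ [omega [[_ Fm] [_ Fn]]]; apply: tF => //; exists omega.
rewrite -setI_bigcupr -FU; apply/esym/setIidl => omega; by case.
Qed.

Let measurable_kernel : measurable_fun [set: Omega]
  (EFin \o (fun omega => P g (past (chain omega) i))).
Proof.
apply/measurable_EFinP.
apply: (@measurableT_comp _ _ _ Omega (histG G) R (P g) setT
  (fun omega => past (chain omega) i)); first by case: hP.
apply: (@measurableT_comp _ _ _ Omega (letterSeq G D0) (histG G)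
  (fun eta => past eta i) setT chain); first exact: measurable_past.
exact: measurable_chain.
Qed.

Let target : set Omega := [set omega | chain omega i = g] `&` preC.

Let measurable_target : measurable target.
Proof.
apply: measurableI => //.
apply: (@measurable_upath_preimage _ _ _ _ U setT [set u | Phi_map P rk g0 u i = g]).
exact: measurable_Phi_map_letter.
Qed.

Let null : set Omega := ~` [set omega | (-oo < tau P (upath U omega) i i%:E)%E].

Let measurable_null : measurable null.
Proof.
rewrite (_ : null = upath U @^-1` [set u : seqR R | forall k : int, ~ regen P u i i%:E%E k]).
  apply: measurable_upath_preimage; apply: measurable_forall => [|k].
    exact: countableP.
  by apply: measurableC; exact: measurable_regen.
apply/seteqP; split => omega /=; rewrite /null/= => h.
  by move=> k rk'; apply: h; apply/tau_NyP; exists k.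
by move=> /tau_NyP[k]; exact: h.
Qed.

Let null0 : Prob null = 0%E.
Proof.
rewrite probability_setC ?tau_fin ?subee// -[X in measurable X]setCK.
exact: measurableC.
Qed.

Let exceed k : set Omega := U i @^-1` [set x | a_tot P k <= x < 1].

Let measurable_exceed k : measurable (exceed k).
Proof.
apply: measurable_U_preimage.
rewrite (_ : [set x | _] = [set` `[a_tot P k, (1:R)[]); first exact: measurable_itv.
by apply/seteqP; split => x; rewrite /= in_itv.
Qed.

Let exceed_prob k : Prob (exceed k) = (1 - a_tot P k)%:E.
Proof.
rewrite (U_law U_iid) ?uniform_prob_itv ?a_tot_ge0 ?a_tot_le1//.
rewrite (_ : [set x | _] = [set` `[a_tot P k, (1:R)[]); first exact: measurable_itv.
by apply/seteqP; split => x; rewrite /= in_itv.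
Qed.

Let regular omega : ~ null omega ->
  chain omega i = letter P rk g0 (U i omega) (past (chain omega) i).
Proof.
move=> /contrapT tf.
by rewrite {1}/chain (Phi_map_letter g0 hP rk_inj (upath_unit U_iid omega) tf).
Qed.

Let hits_sub k : hits k `<=` target `|` null.
Proof.
move=> omega [/= [l lk B] c].
have [nu|nnu] := pselect (null omega); [by right|left]; split=> //=.
rewrite (regular nnu); apply: (letterE hP rk_inj g0 (l := l)).
by rewrite -(Bint_agree hP rk g (agree_le lk (@nth_history k (chain omega)))).
Qed.

Let target_sub k : target `<=` hits k `|` (null `|` exceed k).
Proof.
move=> omega [/= Xg c].
have [nu|nnu] := pselect (null omega); [by right; left|].
have /andP[u0 u1] := upath_unit U_iid omega i.
have [ak|ka] := leP (a_tot P k) (U i omega); first by right; right; rewrite /exceed/= ak.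
left; split=> //=.
have uk : 0 <= U i omega < a_tot P k by rewrite u0.
have [l lk B] := letter_Bint hP rk_inj g0 (past (chain omega) i) uk.
exists l => //; rewrite (Bint_agree hP rk g (agree_le lk (@nth_history k (chain omega)))).
by rewrite -Xg (regular nnu).
Qed.

Let measurable_hits k : measurable (hits k).
Proof.
have mE s : measurable (U i @^-1` upto k s `&` event k s).
  by apply: measurableI; [exact: measurable_U_preimage|exact: measurable_event].
rewrite (_ : hits k = \bigcup_s (U i @^-1` upto k s `&` event k s)).
  apply: countable_bigcupT_measurable => //; exact: countable_seq rk_inj.
rewrite /hits /event; apply/seteqP; split => omega.
  case=> h c; exists (history k (chain omega)); first exact I.
  split; last by split; [reflexivity|exact c].
  by move: h; rewrite /mkset; exact id.
case=> s _ [h [hs c]]; split; last exact c.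
move: hs h => /= ->; exact.
Qed.

Lemma chain_cond_prob : (\int[Prob]_(omega in preC) (P g (past (chain omega) i))%:E =
  Prob ([set omega | chain omega i = g] `&` preC))%E.
Proof.
rewrite -/target.
have mU A B : measurable A -> measurable B -> (Prob (A `|` B) <= Prob A + Prob B)%E.
  exact: measureU2.
have close k : (Prob target <= Prob (hits k) + (1 - a_tot P k)%:E)%E.
  apply: le_trans (le_measure Prob _ _ (@target_sub k)) _; rewrite ?inE//.
    by apply: measurableU => //; exact: measurableU.
  apply: le_trans (mU _ _ _ _) _ => //; first exact: measurableU.
  rewrite leeD2l// -exceed_prob; apply: le_trans (mU _ _ _ _) _ => //.
  by rewrite null0 add0e.
have close' k : (Prob (hits k) <= Prob target)%E.
  apply: le_trans (le_measure Prob _ _ (@hits_sub k)) _; rewrite ?inE//.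
    exact: measurableU.
  by apply: le_trans (mU _ _ _ _) _ => //; rewrite null0 adde0.
have ker k : (Prob (hits k) <=
    \int[Prob]_(omega in preC) (P g (past (chain omega) i))%:E)%E.
  rewrite hits_prob; apply: ge0_le_integral => //.
  - by move=> omega _; rewrite lee_fin a_word_ge0.
  - exact: measurable_funTS (measurable_a_word k).
  - exact: measurable_funTS measurable_kernel.
  - by move=> omega _; rewrite lee_fin a_word_le.
have ker' k : (\int[Prob]_(omega in preC) (P g (past (chain omega) i))%:E <=
    Prob (hits k) + (1 - a_tot P k)%:E)%E.
  rewrite hits_prob.
  apply: (@le_trans _ _ (\int[Prob]_(omega in preC)
      ((a_word P k g (past (chain omega) i))%:E + (cst (1 - a_tot P k)%:E) omega))%E).
    apply: ge0_le_integral => //.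
    - by move=> omega _; rewrite lee_fin kernel_ge0.
    - exact: measurable_funTS measurable_kernel.
    - apply: measurable_funTS; apply: emeasurable_funD => //.
      exact: measurable_a_word.
    - move=> omega _; rewrite -EFinD lee_fin -lerBlDl.
      exact: kernel_sub_a_word.
  rewrite ge0_integralD//.
  - rewrite leeD2l// integral_cst//.
    apply: (@le_trans _ _ ((1 - a_tot P k)%:E * 1)%E); last by rewrite mule1.
    by rewrite lee_wpmul2l ?probability_le1// lee_fin subr_ge0 a_tot_le1.
  - by move=> omega _; rewrite lee_fin a_word_ge0.
  - exact: measurable_funTS (measurable_a_word k).
  - by move=> omega _; rewrite lee_fin subr_ge0 a_tot_le1.
apply/eqP; rewrite eq_le; apply/andP; split; apply/lee_addgt0Pr => e e0;
  have [k ke] := a_small e0.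
- by apply: le_trans (ker' k) _; apply: leeD; rewrite ?lee_fin.
- by apply: le_trans (close k) _; apply: leeD; rewrite ?lee_fin.
Qed.

End Compatibility.

(** * Decay of the return probabilities *)

Section Decay.
Variables (R : realType) (a : nat -> R).
Hypothesis a_ge0 : forall k, 0 <= a k.
Hypothesis a_le1 : forall k, a k <= 1.
Hypothesis a_mono : forall k l, (k <= l)%N -> a k <= a l.
Hypothesis surv_unbdd : forall M, exists n, M <= \sum_(j < n) surv a j.

Let q j := surv a j - surv a j.+1.

Lemma surv_diff_ge0 j : 0 <= q j.
Proof. by rewrite subr_ge0 surv_stepP. Qed.

Lemma surv_diff_le j : q j <= 1 - a j.
Proof.
rewrite /q survS -[X in X - _]mulr1 -mulrBr ler_piMl ?subr_ge0// surv_le1//.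
Qed.

Lemma surv_diff_sum n : \sum_(j < n) q j = 1 - surv a n.
Proof.
elim: n => [|n IH]; first by rewrite big_ord0 surv0 subrr.
by rewrite big_ord_recr/= IH /q addrA subrK.
Qed.

Lemma surv_gt0 n : 0 < surv a n.
Proof.
rewrite lt_def surv_ge0// andbT; apply/eqP => s0.
have [N] := surv_unbdd n.+1%:R.
suff : \sum_(j < N) surv a j <= n%:R.
  by move=> h1 h2; have := le_trans h2 h1; rewrite ler_nat ltnn.
apply: (@le_trans _ _ (minn N n)%:R); last by rewrite ler_nat geq_minr.
elim: N => [|N IH]; first by rewrite big_ord0.
rewrite big_ord_recr/=; have [Nn|nN] := ltnP N n.
  move: IH; rewrite (minn_idPl Nn) (minn_idPl (ltnW Nn)) -natr1 => IH.
  by rewrite lerD// surv_le1.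
have -> : surv a N = 0.
  by apply/eqP; rewrite eq_le surv_ge0// andbT -s0 surv_antitone.
by move: IH; rewrite addr0 (minn_idPr nN) (minn_idPr (leqW nN)).
Qed.

Lemma a_tot_small_gap e : 0 < e -> exists k, 1 - a k <= e.
Proof.
move=> e0; apply: contrapT => ne.
have ea k : e < 1 - a k by rewrite ltNge; apply/negP => h; apply: ne; exists k.
have [n Hn] := surv_unbdd (2 / e).
have : e * \sum_(j < n) surv a j <= 1.
  apply: (@le_trans _ _ (1 - surv a n)); last by rewrite lerBlDr lerDl surv_ge0.
  rewrite -surv_diff_sum mulr_sumr; apply: ler_sum => j _.
  rewrite /q survS -[X in X - _]mulr1 -mulrBr mulrC ler_wpM2l ?surv_ge0//.
  exact: ltW.
have : 2 <= e * \sum_(j < n) surv a j by rewrite mulrC -ler_pdivrMr.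
by move=> h1 h2; have := le_trans h1 h2; lra.
Qed.

Lemma surv_weierstrass K N :
  surv a K * (1 - \sum_(j < N) (1 - a (K + j)%N)) <= surv a (K + N).
Proof.
elim: N => [|N IH]; first by rewrite big_ord0 subr0 mulr1 addn0.
rewrite big_ord_recr/= addnS survS.
have S0 : 0 <= \sum_(j < N) (1 - a (K + j)%N).
  by apply: sumr_ge0 => j _; rewrite subr_ge0.
move: (\sum_(j < N) _) S0 IH => S S0 IH.
apply: (@le_trans _ _ (surv a K * (1 - S) * a (K + N)%N)); last first.
  by rewrite ler_wpM2r.
rewrite -mulrA ler_wpM2l ?surv_ge0//.
have : 0 <= S * (1 - a (K + N)%N) by rewrite mulr_ge0// subr_ge0.
lra.
Qed.

Lemma surv_bounded_below K :
  (forall N, \sum_(j < N) (1 - a (K + j)%N) <= 2^-1) ->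
  exists2 b, 0 < b & forall n, b <= surv a n.
Proof.
move=> H; exists (surv a K / 2); first by rewrite divr_gt0// surv_gt0.
move=> n; have [nK|Kn] := leqP n K.
  apply: le_trans (surv_antitone a_ge0 a_le1 nK).
  by rewrite ler_pdivrMr// ler_peMr ?surv_ge0//; lra.
rewrite -(subnKC (ltnW Kn)); apply: le_trans (surv_weierstrass _ _).
by rewrite ler_wpM2l ?surv_ge0//; have := H (n - K)%N; lra.
Qed.

Lemma geometric_tail (C l e : R) : 0 <= C -> 0 <= l -> l < 1 -> 0 < e ->
  exists K, forall N, \sum_(j < N) C * l ^+ (K + j) <= e.
Proof.
move=> C0 l0 l1 e0.
have l1' : 0 < 1 - l by rewrite subr_gt0.
have geo N K : \sum_(j < N) C * l ^+ (K + j) <= C * l ^+ K / (1 - l).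
  rewrite ler_pdivlMr// mulr_suml.
  rewrite (eq_bigr (fun j : 'I_N => C * l ^+ (K + j) - C * l ^+ (K + j.+1))); last first.
    by move=> j _; rewrite addnS exprS; ring.
  elim: N => [|N IH]; first by rewrite big_ord0 mulr_ge0// exprn_ge0.
  suff : \sum_(j < N.+1) (C * l ^+ (K + j) - C * l ^+ (K + j.+1)) =
      C * l ^+ K - C * l ^+ (K + N.+1).
    by move=> ->; rewrite lerBlDr lerDl mulr_ge0// exprn_ge0.
  elim: {IH} N => [|N IH]; first by rewrite big_ord1 addn0.
  by rewrite big_ord_recr/= IH addrA subrK.
have [K HK] : exists K, l ^+ K <= e * (1 - l) / (C + 1).
  have d0 : 0 < e * (1 - l) / (C + 1) by rewrite divr_gt0 ?mulr_gt0// ltr_wpDl.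
  have /cvgr0Pnorm_le/(_ _ d0)[K _ HK] : (fun n => l ^+ n) @ \oo --> (0 : R).
    by apply: cvg_expr; rewrite ger0_norm.
  by exists K; apply: le_trans (HK K (leqnn K)); exact: ler_norm.
exists K => N; apply: le_trans (geo N K) _.
rewrite ler_pdivrMr//; move: HK; rewrite ler_pdivlMr ?ltr_wpDl//.
have : 0 <= l ^+ K by rewrite exprn_ge0.
lra.
Qed.

Lemma bernoulli (x : R) n : 0 <= x <= 1 -> 1 - n%:R * x <= (1 - x) ^+ n.
Proof.
move=> /andP[x0 x1]; elim: n => [|n IH]; first by rewrite mul0r subr0.
rewrite exprS -natr1.
have h : (1 - x) * (1 - n%:R * x) <= (1 - x) * (1 - x) ^+ n.
  by rewrite ler_wpM2l// subr_ge0.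
have : 0 <= n%:R * x * x by rewrite !mulr_ge0.
lra.
Qed.

Lemma sum_tail_le (F : nat -> R) (e : R) J n : 0 <= e ->
  (forall N, \sum_(i < N) F (J + i)%N <= e) ->
  \sum_(j < n) (if (j < J)%N then 0 else F j) <= e.
Proof.
move=> e0 He; have [nJ|Jn] := leqP n J.
  by rewrite big1// => j _; rewrite (leq_trans (ltn_ord j) nJ).
rewrite -(subnKC (ltnW Jn)) big_split_ord/= big1 ?add0r => [|j _]; last by rewrite ltn_ord.
apply: le_trans (He (n - J)%N); apply: ler_sum => j _.
by rewrite ltnNge leq_addr.
Qed.

(* If the law of the return time has exponential tails and total mass at most 1 - b < 1, then
   its generating function is still at most 1 at some radius 1 / th > 1. *)
Lemma ret_exp_decay : exp_decay (fun k => 1 - a k) -> exp_decay (fun n => ret a n 0).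
Proof.
move=> [C [l [l0 l1 Hl]]].
have C0 : 0 <= C.
  by have := Hl 0%N; rewrite expr0 mulr1; apply: le_trans; rewrite subr_ge0.
have h2 : (0 : R) < 2^-1 by rewrite invr_gt0.
have [K HK] := @geometric_tail C l 2^-1 C0 l0 l1 h2.
have [b b0 Hb] : exists2 b, 0 < b & forall n, b <= surv a n.
  apply: (@surv_bounded_below K) => N; apply: le_trans (HK N).
  by apply: ler_sum => j _; exact: Hl.
have b1 : b <= 1 by rewrite -(surv0 a).
pose k0 := 2 / (1 + l); pose m := k0 * l.
have l1p : 0 < 1 + l by lra.
have k01 : 1 < k0 by rewrite /k0 ltr_pdivlMr//; lra.
have k0p : 0 < k0 by lra.
have m0 : 0 <= m by rewrite mulr_ge0// ltW.
have m1 : m < 1 by rewrite /m /k0 mulrAC ltr_pdivrMr//; lra.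
have Ck0 : 0 <= C * k0 by rewrite mulr_ge0// ltW.
have b2 : 0 < b / 2 by rewrite divr_gt0.
have [J HJ] := @geometric_tail (C * k0) m (b / 2) Ck0 m0 m1 b2.
have J0 : 0 < J.+1%:R :> R by rewrite ltr0n.
pose e := Num.min (b / 4 / J.+1%:R) (1 - k0^-1).
have k0i : k0^-1 < 1 by rewrite invf_lt1.
have k0ip : 0 < k0^-1 by rewrite invr_gt0.
have e0 : 0 < e by rewrite lt_min divr_gt0 ?divr_gt0//= subr_gt0.
have e1 : J%:R * e <= b / 4.
  apply: (@le_trans _ _ (J.+1%:R * e)); first by rewrite ler_wpM2r ?ler_nat// ltW.
  by rewrite mulrC -ler_pdivlMr// ge_min lexx.
have e2 : e <= 1 - k0^-1 by rewrite ge_min lexx orbT.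
pose th := 1 - e.
have thk : k0^-1 <= th by rewrite /th; lra.
have th0 : 0 < th by apply: lt_le_trans thk; rewrite invr_gt0.
have th1 : th < 1 by rewrite /th; lra.
have kk0 : th^-1 <= k0 by rewrite -[k0]invrK lef_pV2 ?posrE ?invr_gt0.
have k1 : 1 <= th^-1 by rewrite invf_ge1// ltW.
have kJ : th^-1 ^+ J <= 1 + b / 2.
  have b2p : 0 < 1 + b / 2 by lra.
  rewrite exprVn -[leRHS]invrK lef_pV2 ?posrE ?invr_gt0 ?exprn_gt0//.
  apply: (@le_trans _ _ (1 - b / 4)).
    rewrite -[leLHS]mul1r ler_pdivrMr//.
    have : 0 <= b * (1 - b) by rewrite mulr_ge0 ?subr_ge0// ltW.
    lra.
  have : 1 - J%:R * e <= th ^+ J by apply: bernoulli; rewrite ltW//=; lra.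
  lra.
have gen n : \sum_(j < n) q j * th^-1 ^+ j.+1 <= 1.
  apply: (@le_trans _ _ (\sum_(j < n) ((1 + b / 2) * q j +
      (if (j < J)%N then 0 else C * k0 * m ^+ j)))).
    apply: ler_sum => j _; have qj := surv_diff_ge0 j.
    case: ltnP => jJ.
      rewrite addr0 mulrC ler_wpM2r//; apply: le_trans kJ.
      by rewrite ler_weXn2l.
    apply: ler_wpDl; first by rewrite mulr_ge0//; lra.
    have -> : C * k0 * m ^+ j = (C * l ^+ j) * k0 ^+ j.+1.
      by rewrite /m exprMn exprS; ring.
    apply: ler_pM => //; first by rewrite exprn_ge0// invr_ge0 ltW.
      exact: le_trans (surv_diff_le j) (Hl j).
    by rewrite lerXn2r// nnegrE ?invr_ge0 ltW.
  rewrite big_split/= -mulr_sumr surv_diff_sum.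
  have := @sum_tail_le (fun j => C * k0 * m ^+ j) (b / 2) J n (ltW b2) HJ.
  have : (1 + b / 2) * (1 - surv a n) <= (1 + b / 2) * (1 - b).
    by rewrite ler_wpM2l ?lerD2l ?lerN2//; lra.
  nra.
exists 1, th; split; [exact: ltW|exact: th1|].
move=> n; rewrite mul1r; have [N] := ubnP n; elim: N n => // N IH [|n] nN; first by [].
rewrite first_return; apply: (@le_trans _ _ (\sum_(j < n.+1) q j * th^-1 ^+ j.+1 * th ^+ n.+1)).
  apply: ler_sum => j _; rewrite -mulrA ler_wpM2l ?surv_diff_ge0//.
  have jn : (j <= n)%N by rewrite -ltnS.
  have h : ret a (n - j) 0 <= th ^+ (n - j).
    by apply: IH; rewrite (leq_ltn_trans (leq_subr j n)).
  apply: (le_trans h).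
  have -> : th ^+ n.+1 = th ^+ j.+1 * th ^+ (n - j) by rewrite -exprD addSn subnKC.
  by rewrite mulrA exprVn mulVf ?mul1r// expf_neq0// gt_eqF.
by rewrite -mulr_suml ler_piMl// exprn_ge0// ltW.
Qed.

Section Power.
Variable gamma : R.
Hypothesis gamma_gt1 : 1 < gamma.

Let p (n : nat) : R := n.+1%:R `^ (- gamma).

Let gamma_ge0 : 0 <= gamma.
Proof. exact: le_trans ler01 (ltW gamma_gt1). Qed.

Let p_gt0 n : 0 < p n.
Proof. by rewrite powR_gt0// ltr0n. Qed.

Lemma powRN_scale (c x y : R) : 0 < c -> 0 < y -> c * y <= x ->
  x `^ (- gamma) <= c `^ (- gamma) * y `^ (- gamma).
Proof.
move=> c0 y0 cyx; have cy0 : 0 < c * y by rewrite mulr_gt0.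
have x0 : 0 < x := lt_le_trans cy0 cyx.
rewrite -(powRM _ (ltW c0) (ltW y0)) !powRN lef_pV2 ?posrE ?powR_gt0//.
by apply: ge0_ler_powR => //; rewrite nnegrE ltW.
Qed.

Let p_antitone m n : (m <= n)%N -> p n <= p m.
Proof.
move=> mn; have := @powRN_scale 1 n.+1%:R m.+1%:R ltr01 (ltr0Sn _ _).
by rewrite powR1 !mul1r ler_nat ltnS; apply.
Qed.

Let p_telescope k : (0 < k)%N ->
  p k <= (gamma - 1)^-1 * (k%:R `^ (1 - gamma) - k.+1%:R `^ (1 - gamma)).
Proof.
move=> k0; have d0 : 0 < gamma - 1 by rewrite subr_gt0.
have kR : 0 < k%:R :> R by rewrite ltr0n.
have k1R : 0 < k.+1%:R :> R by rewrite ltr0n.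
rewrite mulrC ler_pdivlMr// lerBrDr.
have -> : p k = k.+1%:R^-1 * k.+1%:R `^ (1 - gamma).
  have k1N : k.+1%:R != 0 :> R by rewrite gt_eqF.
  rewrite powRD; last by rewrite k1N implybT.
  by rewrite powRr1 ?(ltW k1R)// mulKf.
have ln_le : ln k%:R - ln k.+1%:R <= - k.+1%:R^-1 :> R.
  rewrite -ln_div ?posrE//.
  have -> : k%:R / k.+1%:R = 1 + (- k.+1%:R^-1) :> R.
    by rewrite -natr1; field; rewrite natr1 gt_eqF.
  by rewrite le_ln1Dx// ltrN2 invf_lt1// ltr1n.
have -> : k%:R `^ (1 - gamma) = k.+1%:R `^ (1 - gamma) *
    expR ((gamma - 1) * (ln k.+1%:R - ln k%:R)) :> R.
  by rewrite /powR !gt_eqF// -expRD; congr expR; ring.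
move: (k.+1%:R `^ _) (powR_ge0 k.+1%:R (1 - gamma)) => y y0.
rewrite mulrAC [_ * y]mulrC -[X in _ + X]mulr1 -mulrDr ler_wpM2l//.
apply: le_trans (expR_ge1Dx _); rewrite addrC lerD2l mulrC ler_wpM2l ?(ltW d0)//.
by rewrite -lerN2 opprB.
Qed.

Let p_tail (e : R) : 0 < e -> exists K, forall N, \sum_(j < N) p (K + j) <= e.
Proof.
move=> e0; have d0 : 0 < gamma - 1 by rewrite subr_gt0.
have tel K N : (0 < K)%N -> \sum_(j < N) p (K + j) <=
    (gamma - 1)^-1 * (K%:R `^ (1 - gamma) - (K + N)%:R `^ (1 - gamma)).
  move=> K0; elim: N => [|N IH]; first by rewrite big_ord0 addn0 subrr mulr0.
  rewrite big_ord_recr/=; have := @p_telescope (K + N)%N; rewrite addn_gt0 K0 => /(_ isT).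
  by rewrite addnS => h; apply: le_trans (lerD IH h) _; rewrite -mulrDr addrA subrK.
pose K := (Num.bound (expR (- ln ((gamma - 1) * e) / (gamma - 1)))).+1.
exists K => N; apply: le_trans (tel K N isT) _.
have KR : 0 < K%:R :> R by rewrite ltr0n.
rewrite mulrC ler_pdivrMr// mulrC.
apply: (@le_trans _ _ (K%:R `^ (1 - gamma))); first by rewrite lerBlDr lerDl powR_ge0.
have de : 0 < (gamma - 1) * e by rewrite mulr_gt0.
rewrite /powR gt_eqF// -[leRHS]lnK ?posrE// ler_expR.
have : - ln ((gamma - 1) * e) / (gamma - 1) <= ln K%:R.
  rewrite -[leLHS]expRK ler_ln ?posrE ?expR_gt0//.
  apply: ltW; apply: lt_le_trans (archi_boundP (expR_ge0 _)) _.
  by rewrite ler_nat.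
rewrite ler_pdivrMr//; lra.
Qed.

Hypothesis gap_O : (fun k => 1 - a k) =O_\oo (fun k : nat => k%:R `^ (- gamma)).

Lemma gap_le_p : exists2 C, 0 < C & forall k, 1 - a k <= C * p k.
Proof.
have /eqO_exP[C C0 [N _ HN]] := gap_O.
pose N' := maxn N 1.
have hh : (0 : R) < 2^-1 by rewrite invr_gt0.
exists (C * 2^-1 `^ (- gamma) + (p N')^-1).
  by rewrite addr_gt0 ?mulr_gt0 ?powR_gt0// invr_gt0 p_gt0.
move=> k; rewrite mulrDl; have pk := p_gt0 k; have [kN|Nk] := leqP N' k.
  have k0 : (0 < k)%N by apply: leq_trans kN; rewrite leq_max orbT.
  apply: ler_wpDr; first by rewrite mulr_ge0// ?invr_ge0 (ltW (p_gt0 _)).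
  have /HN/= : (N <= k)%N by apply: leq_trans kN; rewrite leq_maxl.
  rewrite ger0_norm ?subr_ge0// ger0_norm ?powR_ge0// => /le_trans; apply.
  rewrite -mulrA ler_wpM2l ?(ltW C0)//; apply: powRN_scale => //.
  rewrite -[k.+1%:R]natr1; have : (1 : R) <= k%:R by rewrite ler1n.
  lra.
apply: ler_wpDl; first by rewrite !mulr_ge0 ?powR_ge0// ltW.
apply: (@le_trans _ _ 1); first by rewrite lerBlDr lerDl.
by rewrite mulrC ler_pdivlMr ?p_gt0// mul1r p_antitone// ltnW.
Qed.

(* A return time is either at most a fraction 1/D of n, which costs a factor arbitrarily close
   to 1 in the power law, or so long that its own probability decays like the power. *)
Lemma ret_power_decay : (fun n => ret a n 0) =O_\oo (fun k : nat => k%:R `^ (- gamma)).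
Proof.
have [C C0 HC] := gap_le_p.
have h2 : (0 : R) < 2^-1 / C by rewrite divr_gt0// invr_gt0.
have [K HK] := p_tail h2.
have [b b0 Hb] : exists2 b, 0 < b & forall n, b <= surv a n.
  apply: (@surv_bounded_below K) => N.
  apply: (@le_trans _ _ (C * \sum_(j < N) p (K + j))).
    by rewrite mulr_sumr; apply: ler_sum => j _; exact: HC.
  by rewrite mulrC -ler_pdivlMr.
have b1 : b <= 1 by rewrite -(surv0 a).
pose m := Num.bound gamma.
pose D := (Num.bound (2 * m%:R / b)).+2.
have D0 : 0 < D%:R :> R by rewrite ltr0n.
have Di : 0 < D%:R^-1 :> R by rewrite invr_gt0.
have D1 : D%:R^-1 < 1 :> R by rewrite invf_lt1// ltr1n.
pose c : R := 1 - D%:R^-1.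
have c0 : 0 < c by rewrite /c; lra.
pose r := c `^ (- gamma).
have mD : m%:R * D%:R^-1 <= b / 2.
  rewrite ler_pdivrMr//.
  have : 2 * m%:R / b <= D%:R.
    apply: ltW; apply: lt_le_trans (archi_boundP _) _; last by rewrite ler_nat; exact: leqW.
    by rewrite divr_ge0 ?mulr_ge0// ltW.
  by rewrite ler_pdivrMr// => h; lra.
have cm : 1 - b / 2 <= c ^+ m.
  have Dx : 0 <= (D%:R^-1 : R) <= 1 by rewrite (ltW Di) (ltW D1).
  by apply: le_trans (bernoulli m Dx); rewrite lerD2l lerN2.
have rb : (1 - b) * r <= 1 - b / 2.
  have b2 : 0 < 1 - b / 2 by lra.
  have rr : r <= (1 - b / 2)^-1.
    rewrite /r -mulN1r powRrM powR_inv1 ?(ltW c0)//.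
    apply: (@le_trans _ _ (c^-1 `^ m%:R)).
      apply: ler_powR; first by rewrite invf_ge1// /c; lra.
      by apply/ltW/archi_boundP.
    by rewrite powR_mulrn ?invr_ge0 ?(ltW c0)// exprVn lef_pV2 ?posrE ?exprn_gt0.
  apply: (@le_trans _ _ ((1 - b) * (1 - b / 2)^-1)).
    by rewrite ler_wpM2l// subr_ge0.
  rewrite ler_pdivrMr//; nra.
pose E := D%:R^-1 `^ (- gamma).
have E0 : 0 <= E by exact: powR_ge0.
have r0 : 0 <= r by exact: powR_ge0.
pose M := 1 + 2 * C * E / b ^+ 2.
have M1 : 1 <= M.
  by rewrite lerDl divr_ge0 ?exprn_ge0 ?mulr_ge0 ?(ltW b0) ?(ltW C0).
have M0 : 0 <= M := le_trans ler01 M1.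
have short n j : (D * j.+1 <= n.+2)%N -> (j <= n)%N -> p (n - j) <= r * p n.+1.
  move=> Dj jn; apply: powRN_scale => //.
  have : D%:R * j.+1%:R <= n.+2%:R :> R by rewrite -natrM ler_nat.
  rewrite mulrC -ler_pdivlMr// => h.
  have -> : (n - j).+1%:R = n.+2%:R - j.+1%:R :> R.
    by rewrite -natrB ?subSS// ?subSn//; exact: leqW.
  rewrite /c mulrBl mul1r [_^-1 * _]mulrC; lra.
have long n j : ~~ (D * j.+1 <= n.+2)%N -> p j <= E * p n.+1.
  rewrite -ltnNge => nD; apply: powRN_scale => //.
  by rewrite mulrC ler_pdivrMr// -natrM ler_nat mulnC ltnW.
have main n : ret a n 0 <= M * p n.
  have [N] := ubnP n; elim: N n => // N IH [|n] nN.
    by rewrite /p powR1 mulr1.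
  have pn := p_gt0 n.+1.
  rewrite first_return; apply: (@le_trans _ _ (\sum_(j < n.+1)
      (M * r * p n.+1 * q j + C * E * p n.+1 * ret a (n - j) 0))).
    apply: ler_sum => j _.
    have qj := surv_diff_ge0 j; have rj := ret_ge0 a_ge0 a_le1 (n - j) 0.
    have jn : (j <= n)%N by rewrite -ltnS.
    have [sj|lj] := boolP (D * j.+1 <= n.+2)%N.
      apply: ler_wpDr; first by rewrite !mulr_ge0// ltW.
      rewrite mulrC ler_wpM2r//; apply: le_trans (_ : M * p (n - j) <= _).
        by apply: IH; rewrite (leq_ltn_trans (leq_subr j n)).
      by rewrite -mulrA ler_wpM2l// short.
    apply: ler_wpDl; first by rewrite !mulr_ge0// ltW.
    rewrite ler_wpM2r//; apply: le_trans (surv_diff_le j) _.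
    by apply: le_trans (HC j) _; rewrite -mulrA ler_wpM2l ?(ltW C0)// long.
  rewrite big_split/= -!mulr_sumr surv_diff_sum.
  have S1 : \sum_(j < n.+1) ret a (n - j) 0 <= b^-1.
    rewrite -[b^-1]mul1r ler_pdivlMr//.
    apply: le_trans (ret_sum_surv a_ge0 a_le1 n); rewrite mulrC.
    rewrite [in leRHS](reindex_inj rev_ord_inj)/=.
    under [in leRHS]eq_bigr do rewrite subSS.
    by rewrite ler_wpM2r// sumr_ge0// => j _; exact: ret_ge0.
  apply: (@le_trans _ _ (M * r * p n.+1 * (1 - b) + C * E * p n.+1 * b^-1)).
    apply: lerD; first by rewrite ler_wpM2l ?mulr_ge0 ?lerD2l ?lerN2// ltW.
    by rewrite ler_wpM2l ?mulr_ge0// ltW.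
  have -> : M * r * p n.+1 * (1 - b) + C * E * p n.+1 * b^-1 =
     (M * ((1 - b) * r) + C * E / b) * p n.+1 by ring.
  rewrite ler_wpM2r ?(ltW pn)//.
  apply: (@le_trans _ _ (M * (1 - b / 2) + C * E / b)).
    by rewrite lerD2r ler_wpM2l.
  have -> : C * E / b = (M - 1) * (b / 2).
    by rewrite /M; field; rewrite gt_eqF.
  nra.
apply/eqO_exP; exists M; first by lra.
exists 1%N => // k /= k1.
have kR : 0 < k%:R :> R by rewrite ltr0n.
rewrite ger0_norm ?ret_ge0// ger0_norm ?powR_ge0//; apply: le_trans (main k) _.
rewrite ler_wpM2l//; have := @powRN_scale 1 k.+1%:R k%:R ltr01 kR.
by rewrite powR1 !mul1r ler_nat; apply.
Qed.

End Power.
End Decay.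

Theorem theorem4p3 (R : realType) (G : pointedType)
  (rk : G -> nat) (rk_inj : injective rk)
  (P : G -> (nat -> G) -> R) (P_kernel : transition_kernel P) (g0 : G)
  (d : measure_display) (Omega : measurableType d)
  (Prob : probability Omega R) (U : int -> {RV Prob >-> R})
  (U_iid : iid_uniform U)
  (beta_sum : (\sum_(0 <= m <oo) (beta P m)%:E = +oo)%E) :
  let u (omega : Omega) : seqR R := fun i => U i omega in
  let T (s : int) (t : \bar int) (omega : Omega) := tau P (u omega) s t in
  let finite_tau (s : int) (t : \bar int) :=
    Prob [set omega | (-oo < T s t omega)%E] = 1%E in
  let local_dependence (Phi : seqR R -> seqG G) (s : int) (t : \bar int) :=
    forall omega, (-oo < T s t omega)%E ->
    forall v, unit_seq v -> forall i : int, s <= i -> (i%:E <= t)%E ->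
      Phi (u omega) i =
      Phi (replace_outside (T s t omega) t (u omega) v) i in
  let tail (s : int) (t : \bar int) (m : nat) :=
    Prob [set omega | (m%:Z%:E < s%:E - T s t omega)%E] in
  exists2 Phi : seqR R -> seqG G, is_Phi P rk g0 Phi &
  [/\
    (* (i) *)
    forall s t : int, s <= t -> finite_tau s t%:E%E,
    (* (ii) *)
    measurable_fun (@unit_seq R) Phi /\
    (exists mu : probability (seqG G) R,
      [/\ forall A, measurable A ->
            mu A = Prob [set omega | A (Phi (u omega))],
          compatible P mu & stationary mu]),
    (* (iii) *)
    forall s t : int, s <= t -> local_dependence Phi s t%:E%E,
    (* (iv) *)
    [/\ forall (s t : int) (m : nat), s <= t ->
          (tail s t%:E m <= \sum_(i < `|t - s|%N.+1) (rho P (m + i))%:E)%E,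
        exp_decay (fun k => 1 - a_tot P k) -> exp_decay (rho P)
      & forall gamma : R, 1 < gamma ->
          (fun k : nat => 1 - a_tot P k) ~_\oo
            (fun k : nat => k%:R `^ (- gamma)) ->
          rho P =O_\oo (fun k : nat => k%:R `^ (- gamma))] &
    (* (v) *)
    0 < limn (beta P) -> forall s : int,
      [/\ finite_tau s +oo%E,
          local_dependence Phi s +oo%E
        & forall m : nat,
            (tail s +oo m <= \sum_(0 <= i <oo) (rho P (m + i))%:E)%E]].
Proof.
move=> u T finite_tau local_dependence tail.
have a_ge0 := a_tot_ge0 P_kernel; have a_le1 := a_tot_le1 P_kernel.
have a_mono := a_tot_mono P_kernel.
have unbdd := surv_unbounded P_kernel beta_sum.
have rho_ret : rho P = fun n => ret (a_tot P) n 0.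
  by apply/funext => n; exact: rhoE.
have mPhi : measurable_fun [set: seqR R] (Phi_map P rk g0 : _ -> seqG G).
  exact: (measurable_Phi_map g0 P_kernel rk_inj (D := setT) (D' := setT)).
exists (Phi_map P rk g0); first exact: Phi_mapP.
split.
- by move=> s t st; apply: tau_finite.
- split; first exact: measurable_funTS mPhi.
  pose X := chain U P rk g0.
  have mX : measurable_fun [set: Omega] (X : Omega -> seqG G).
    exact: (measurable_chain U g0 P_kernel rk_inj (D := setT)).
  pose mu : probability (seqG G) R :=
    distribution Prob (mfun_Sub (mem_set mX)).
  exists mu; split=> [//||n A mA]; last exact: (chain_stationary U_iid g0 P_kernel rk_inj n mA).
  move=> i g; split=> [B mB|C mC].
    pose D := [set j : int | j < i].
    have mP : measurable_fun [set: letterSeq G D] (fun eta => P g (past eta i)).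
      apply: (@measurableT_comp _ _ _ (letterSeq G D) (histG G) R (P g) setT
        (fun eta => past eta i)); first by case: P_kernel.
      exact: measurable_past.
    by have := mP measurableT B mB; rewrite setTI.
  have mC' : measurable (C : set (seqG G)) := sub_coord_sigma (@subsetT _ _) mC.
  have mPT : measurable_fun [set: seqG G] (EFin \o (fun eta => P g (past eta i))).
    apply/measurable_EFinP.
    apply: (@measurableT_comp _ _ _ (seqG G) (histG G) R (P g) setT
      (fun eta => past eta i)); first by case: P_kernel.
    exact: measurable_past.
  have -> : (\int[mu]_(x in C) (P g (past x i))%:E =
      \int[Prob]_(omega in X @^-1` C) (P g (past (X omega) i))%:E)%E.
    rewrite [LHS](ge0_integral_pushforward mX)//.
    + exact: measurable_funTS mPT.
    + by move=> eta _; rewrite lee_fin kernel_ge0.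
  apply: (chain_cond_prob U_iid g0 P_kernel rk_inj _ _ g mC).
  + move=> e; exact: a_tot_small_gap.
  + by move=> n; exact: tau_finite.
- move=> s t st omega Tfin v v1 i si it.
  exact: Phi_map_replace_outside.
- split.
  + by move=> s t m st; exact: tau_tail_fin_le.
  + by rewrite rho_ret; exact: ret_exp_decay.
  + move=> gamma gamma1 /equivOLR gap; rewrite rho_ret.
    exact: ret_power_decay.
- move=> b0 s; split.
  + exact: tau_finite_inf.
  + move=> omega Tfin v v1 i si it.
    exact: Phi_map_replace_outside.
  + by move=> m; exact: (tau_tail_inf_le U_iid P_kernel).
Qed.
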